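(* Let $\alpha,\beta\ge 2$, let $\kappa=\kappa(\alpha,\beta)$ be the complete bipartite graph on $\alpha$ white and $\beta$ black vertices, and let $TC(\kappa)$ be its associated tile complex. Then the reduced (integral) homology groups of $TC(\kappa)$ are $$\tilde H_n(TC(\kappa))\cong\begin{cases}0 & n=0,\\ \mathbb Z^{\alpha+\beta-2} & n=1,\\ \mathbb Z^{(\alpha-1)(\beta-1)} & n=2,\\ 0 & n\ge 3.\end{cases}$$
   Context: The tile complex $TC(\kappa)$ is the two-dimensional CW-complex obtained as follows. For each pair $(i,j)$, $1\le i\le\alpha$, $1\le j\le\beta$ (i.e. each edge of $\kappa$), take a solid square $A_{ij}$ whose boundary edges, read anticlockwise from a base vertex, are labelled $u_i^1,v_j^1,u_i^2,v_j^2$, each edge directed forward (anticlockwise). The labels $u_i^1,u_i^2$ ($1\le i\le\alpha$) and $v_j^1,v_j^2$ ($1\le j\le\beta$) are all distinct. Then $TC(\kappa)$ is the quotient of the disjoint union of these $\alpha\beta$ squares obtained by gluing together all edges with the same label, respecting their direction. *)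

(* Defs.v *)
From HB Require Import structures.
From mathcomp.multinomials Require Import freeg.
From mathcomp Require Import all_boot all_order all_algebra.
From mathcomp Require Import all_classical all_reals topology normedtype.
From Stdlib Require Import Relation_Operators.

Set Implicit Arguments.
Unset Strict Implicit.
Unset Printing Implicit Defensive.

Import Order.TTheory GRing.Theory Num.Theory.
Import numFieldNormedType.Exports.

Local Open Scope classical_set_scope.
Local Open Scope ring_scope.
Local Open Scope quotient_scope.

(* Coerced to a type, a set carries the subspace topology. *)
Definition simplex (R : realType) (n : nat) : set 'rV[R]_n.+1 :=
  [set x | (forall i, 0 <= x 0 i) /\ \sum_i x 0 i = 1].
Arguments simplex : clear implicits.

Definition coface_row (R : realType) (n : nat) (i : 'I_n.+2)
    (x : 'rV[R]_n.+1) : 'rV[R]_n.+2 :=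
  \row_j (if unlift i j is Some k then x 0 k else 0).

Lemma coface_row_simplex (R : realType) (n : nat) (i : 'I_n.+2)
    (x : simplex R n) : coface_row i (set_val x) \in simplex R n.+1.
Proof.
have [x0 x1] := set_mem (valP x).
rewrite inE; split=> [j|].
  by rewrite mxE; case: unliftP => [k _|_]; [exact: x0|].
rewrite (bigD1_ord i) //= mxE unlift_none add0r -[RHS]x1.
by apply: eq_bigr => j _; rewrite mxE liftK.
Qed.

Definition coface (R : realType) (n : nat) (i : 'I_n.+2)
    (x : simplex R n) : simplex R n.+1 :=
  exist _ (coface_row i (set_val x)) (coface_row_simplex i x).

Lemma coface_continuous (R : realType) (n : nat) (i : 'I_n.+2) :
  continuous (@coface R n i).
Proof.
apply: continuous_comp_initial => x.
suff crc : continuous (@coface_row R n i).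
  apply: (@continuous_comp _ _ _ set_val (@coface_row R n i)); last exact: crc.
  exact: initial_continuous.
move=> {}x A [P xP PA].
exists (fun a k => P a (lift i k)) => [a k|y yP].
  by have := xP a (lift i k); rewrite mxE liftK ord1.
apply: PA => a j; rewrite mxE; case: unliftP => [k ->|->].
  by have := yP a k; rewrite ord1.
by have := nbhs_singleton (xP a i); rewrite mxE unlift_none.
Qed.

HB.instance Definition _ (R : realType) (n : nat) (i : 'I_n.+2) :=
  isContinuous.Build _ _ (@coface R n i) (@coface_continuous R n i).

Section Homology.
Variables (R : realType) (X : topologicalType).

Definition singular (n : nat) : choiceType := continuousType (simplex R n) X.

Definition face (n : nat) (i : 'I_n.+2) (s : singular n.+1) : singular n :=
  ((s : continuousType _ _) \o coface i : continuousType (simplex R n) X).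

Definition chain (n : nat) : lmodType int := {freeg (singular n) / int}.

Definition boundary (n : nat) (c : chain n.+1) : chain n :=
  fglift (fun s => \sum_(i < n.+2) (-1) ^+ i *: (<< face i s >> : chain n)) c.

(* The cycles of the augmented complex: in degree 0 they are the kernel of the
   augmentation, which sums the coefficients. *)
Definition cycles (n : nat) : {pred chain n} :=
  match n with
  | 0 => fun c => deg c == 0
  | m.+1 => fun c => boundary c == 0
  end.

Lemma boundary_is_additive n : {morph @boundary n : c d / c - d}.
Proof. exact: lift_is_additive. Qed.

Lemma cycles_closed n : zmod_closed (@cycles n).
Proof.
case: n => [|n]; split=> [|c d]; rewrite !unfold_in /=.
- by rewrite raddf0.
- by move=> /eqP c0 /eqP d0; rewrite raddfB /= c0 d0 subrr.
- by rewrite -(subrr 0) boundary_is_additive subrr.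
- by move=> /eqP c0 /eqP d0; rewrite boundary_is_additive c0 d0 subrr.
Qed.

HB.instance Definition _ n :=
  GRing.isZmodClosed.Build (chain n) (@cycles n) (@cycles_closed n).

Record cycle_group (n : nat) := Cycle
  { cycle_chain :> chain n; cycle_chainP : cycle_chain \in @cycles n }.

HB.instance Definition _ n := [isSub for @cycle_chain n].
HB.instance Definition _ n := [Choice of cycle_group n by <:].
HB.instance Definition _ n :=
  [SubChoice_isSubZmodule of cycle_group n by <:].

Definition boundaries (n : nat) : {pred cycle_group n} :=
  fun z => `[< exists b : chain n.+1, boundary b = z >].

Lemma boundaries_closed n : zmod_closed (@boundaries n).
Proof.
split=> [|y z]; rewrite !unfold_in.
  by apply/asboolP; exists 0; rewrite -(subrr 0) boundary_is_additive !subrr.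
move=> /asboolP[b by_] /asboolP[d dz]; apply/asboolP; exists (b - d).
by rewrite boundary_is_additive by_ dz.
Qed.

HB.instance Definition _ n :=
  GRing.isZmodClosed.Build (cycle_group n) (@boundaries n) (@boundaries_closed n).

Definition reduced_homology (n : nat) : zmodType :=
  Quotient.quot (@boundaries n).

End Homology.

Definition isomorphic (G H : zmodType) : Prop :=
  exists f : {additive G -> H}, bijective f.

Definition square (R : realType) : set (R * R) :=
  [set p | 0 <= p.1 <= 1 /\ 0 <= p.2 <= 1].
Arguments square : clear implicits.

Inductive side := Bottom | Right | Top | Left.

(* [side_point s] runs along side [s] anticlockwise, as [t] goes from 0 to 1. *)
Definition side_point (R : realType) (s : side) (t : R) : R * R :=
  match s with
  | Bottom => (t, 0)
  | Right => (1, t)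
  | Top => (1 - t, 1)
  | Left => (0, 1 - t)
  end.

Section TileComplex.
Variables (R : realType) (a b : nat).

(* In the complete bipartite graph on [a] white and [b] black vertices, each
   pair of vertices of different colours is an edge. *)
Definition kappa_edge : finType := ('I_a * 'I_b)%type.

(* The labels u_i^1, v_j^1, u_i^2, v_j^2; the base vertex of a tile is the
   corner (0, 0). *)
Inductive edge_label :=
  U1 of 'I_a | V1 of 'I_b | U2 of 'I_a | V2 of 'I_b.

Definition label (e : kappa_edge) (s : side) : edge_label :=
  match s with
  | Bottom => U1 e.1
  | Right => V1 e.2
  | Top => U2 e.1
  | Left => V2 e.2
  end.

Definition tiles : topologicalType := {e : kappa_edge & square R}.

Definition glued (p q : tiles) : Prop :=
  exists (s s' : side) (t : R),
    [/\ 0 <= t <= 1,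
        label (projT1 p) s = label (projT1 q) s',
        set_val (projT2 p) = side_point s t &
        set_val (projT2 q) = side_point s' t].

(* The equivalence relation generated by [glued]; the transitive closure is
   needed at the corners. *)
Definition glue_equiv : rel tiles :=
  fun p q => `[< clos_refl_sym_trans tiles glued p q >].

Lemma glue_equiv_class : equiv_class_of glue_equiv.
Proof.
split=> [p|p q|q p r]; first by apply/asboolP; exact: rst_refl.
  by apply/asboolP/asboolP; exact: rst_sym.
by move=> /asboolP pq /asboolP qr; apply/asboolP; exact: rst_trans pq qr.
Qed.

Canonical glue_equiv_rel := EquivRelPack glue_equiv_class.

Definition TC : topologicalType := quotient_topology {eq_quot glue_equiv}.

End TileComplex.

(* Main.v *)
(* In a tile, the coordinates are glued independently: the index [i] of the tile
   A_ij is forgotten where the first coordinate is 0 or 1, and [j] where the second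
   one is. Hence TC(kappa) is homeomorphic to a product of two graphs, S_alpha x
   S_beta, with S_a the suspension of [a] points (the quotient is compact and the
   product Hausdorff). For every space Y the Mayer-Vietoris argument for the two
   cones of S_(m+1), whose intersection retracts to m + 1 points, gives
     H_n (Y x S_(m+1)) = H_n (Y) (+) H_(n-1) (Y)^m
   in unreduced homology; it is used with Y a point, then with Y = S_beta. The
   chain operators needed (subdivision and its homotopy, prisms) are built by coning
   on the augmented complex of lists of points of a convex space. *)

From HB Require Import structures.
Require Import Defs.
From mathcomp.multinomials Require Import freeg.
From mathcomp Require Import all_boot all_order all_algebra ring lra zify.
From mathcomp Require Import all_classical all_reals topology normedtype.
From mathcomp Require Import sequences realfun.
From Stdlib Require Import Relation_Operators.

Set Implicit Arguments.
Unset Strict Implicit.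
Unset Printing Implicit Defensive.

Import Order.TTheory GRing.Theory Num.Theory.
Import numFieldNormedType.Exports.

Local Open Scope classical_set_scope.
Local Open Scope ring_scope.

(** * Free abelian groups *)

(** No relative homology and no exact sequence of groups is formed. A chain lives in a piece of the
    space when its simplices have their range there ([supp]), and every deformation is a map on all
    of [X * R] that respects the pieces, so that no homotopy has to be defined on a subspace. The
    cover is read off a height function [g]: the cones are [g < 2/3] and [1/3 < g], and a simplex on
    which [g] varies by less than 1/3 lies in one of them. Uniform continuity of one real function
    thus takes the place of a Lebesgue number. The section over a pole splits the Mayer-Vietoris
    sequence: a class is determined by its projection to Y and by the m + 1 components of its
    connecting image, subject to the single relation that their sum is zero. Hence the exponent m.
    With alpha = a + 1 and beta = b + 1, the suspension S_beta has H_0 = Z and H_1 = Z^b, and the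
    second product gives Z^b (+) Z^a in degree 1 and (Z^b)^a in degree 2. Unreduced homology keeps
    the formula uniform; reduction matters only in degree 0, at the very end. *)

(* A constant of type [lmodType int], so that all algebraic structures on chains
   come from a single instance; convertible to [chain] of the definitions. *)
Definition fg (T : choiceType) : lmodType int := {freeg T / int}.

Definition gen (T : choiceType) (t : T) : fg T := << t >>.

Local Notation "<< t >>" := (gen t).

Section FreeAbelian.
Variable T : choiceType.
Implicit Types (c d : fg T) (P Q : T -> Prop).

Definition flin (M : lmodType int) (f : T -> M) : fg T -> M :=
  fglift f.

Lemma flin_is_additive (M : lmodType int) (f : T -> M) :
  zmod_morphism (flin f).
Proof. exact: lift_is_additive. Qed.

HB.instance Definition _ (M : lmodType int) (f : T -> M) :=
  GRing.isZmodMorphism.Build (fg T) M (flin f) (flin_is_additive f).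

Lemma flinE (M : lmodType int) (f : T -> M) t : flin f << t >> = f t.
Proof. by rewrite /flin /gen liftU scale1r. Qed.

Definition allin P c := forall t, t \in dom c -> P t.

Lemma allin_imp P Q c : (forall t, P t -> Q t) -> allin P c -> allin Q c.
Proof. by move=> PQ Pc t /Pc /PQ. Qed.

Lemma allin0 P : allin P 0.
Proof. by move=> t; rewrite dom0. Qed.

Lemma allinU P t : P t -> allin P << t >>.
Proof. by move=> Pt u; rewrite domU1 inE => /eqP ->. Qed.

Lemma allinD P c d : allin P c -> allin P d -> allin P (c + d).
Proof. by move=> Pc Pd t /domD_subset; rewrite mem_cat => /orP[/Pc|/Pd]. Qed.

Lemma allinN P c : allin P c -> allin P (- c).
Proof. by move=> Pc t; rewrite domN => /Pc. Qed.

Lemma allinB P c d : allin P c -> allin P d -> allin P (c - d).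
Proof. by move=> Pc Pd; apply: allinD => //; exact: allinN. Qed.

Lemma allinMz P c (k : int) : allin P c -> allin P (c *~ k).
Proof.
move=> Pc; have H n : allin P (c *+ n).
  by elim: n => [|n IH]; rewrite ?mulr0n ?mulrS; [exact: allin0|exact: allinD].
by case: k => n; rewrite ?NegzE ?mulrNz -pmulrn; [|apply: allinN]; exact: H.
Qed.

Lemma allin_sum (I : Type) (r : seq I) (p : pred I) P (F : I -> fg T) :
  (forall i, allin P (F i)) -> allin P (\sum_(i <- r | p i) F i).
Proof.
move=> PF; elim/big_ind : _ => [|c d|i _]; [exact: allin0|exact: allinD|exact: PF].
Qed.

Lemma freeg_expand c : c = \sum_(t <- dom c) << t >> *~ coeff t c.
Proof.
rewrite -{1}[c]freeg_sumE; apply: eq_bigr => t _.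
by rewrite freegU_mulz intz.
Qed.

(** The extensionality principle behind the chain identities: both sides are packaged as additive
    maps and compared on generators only. *)
Lemma additive_eq_in (M : zmodType) P (f g : {additive fg T -> M}) :
  (forall t, P t -> f << t >> = g << t >>) -> forall c, allin P c -> f c = g c.
Proof.
move=> fg c Pc; rewrite [c]freeg_expand !raddf_sum big_seq [RHS]big_seq.
by apply: eq_bigr => t tc; rewrite !raddfMz fg //; exact: Pc.
Qed.

Lemma additive_eq (M : zmodType) (f g : {additive fg T -> M}) :
  (forall t, f << t >> = g << t >>) -> f =1 g.
Proof. by move=> fg c; apply: (@additive_eq_in _ (fun=> True)) => // t _. Qed.

End FreeAbelian.

Lemma allin_additive (T U : choiceType) (P : T -> Prop) (Q : U -> Prop)
    (f : {additive fg T -> fg U}) c :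
  (forall t, P t -> allin Q (f << t >>)) -> allin P c -> allin Q (f c).
Proof.
move=> PQ Pc; rewrite [c]freeg_expand raddf_sum big_seq.
rewrite -big_filter big_seq; rewrite big_filter_cond.
apply: (big_ind (allin Q)) => [|a b|t /andP[tc _]]; [exact: allin0|exact: allinD|].
by rewrite raddfMz; apply: allinMz; apply: PQ; exact: Pc.
Qed.

Section Restriction.
Variable T : choiceType.
Implicit Types (c d : fg T) (P Q : T -> Prop).

Definition res P : fg T -> fg T :=
  flin (fun t => if `[<P t>] then << t >> else 0 : fg T).

HB.instance Definition _ P := GRing.Additive.on (res P).

Lemma resU P t : res P << t >> = if `[<P t>] then << t >> else 0.
Proof. exact: flinE. Qed.

Lemma res_allin P c : allin P (res P c).
Proof.
apply: (@allin_additive _ _ (fun=> True)) => // t _ /=; rewrite resU.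
by case: asboolP => Pt; [exact: allinU|exact: allin0].
Qed.

Lemma res_id P c : allin P c -> res P c = c.
Proof.
apply: (additive_eq_in (f := res P) (g := idfun)) => t Pt /=.
by rewrite resU asboolT.
Qed.

(** Whatever is left after removing the generators with [P] fails [P], hence satisfies [Q]. A chain
    of small simplices is split between two pieces in this way. *)
Lemma res_sub P Q c : allin (fun t => P t \/ Q t) c -> allin Q (c - res P c).
Proof.
move=> PQc.
have -> : c - res P c = (flin (fun t => << t >> - res P << t >>)) c.
  apply: (additive_eq (f := idfun \- res P)) => t /=.
  by rewrite flinE.
apply: allin_additive PQc => t PQ /=.
rewrite flinE resU; case: asboolP => Pt; first by rewrite subrr; exact: allin0.
by rewrite subr0; apply: allinU; case: PQ.
Qed.

End Restriction.

(** * Chains of lists of points *)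

Section ListChains.
Variable K : choiceType.
Local Notation L := (fg (seq K)).

Definition cone (v : K) : fg (seq K) -> fg (seq K) :=
  flin (fun l => << v :: l >> : L).

HB.instance Definition _ v := GRing.Additive.on (cone v).

Lemma coneU v l : cone v << l >> = << v :: l >>.
Proof. exact: flinE. Qed.

(* The empty list is kept as a generator, in degree -1: in this augmented complex
   [dL_cone] holds without exception in low degrees. *)
Fixpoint dlist (l : seq K) : fg (seq K) :=
  if l is v :: l' then << l' >> - cone v (dlist l') else 0.

Definition dL : fg (seq K) -> fg (seq K) :=
  flin (dlist : _ -> L).

HB.instance Definition _ := GRing.Additive.on dL.

Lemma dLU l : dL << l >> = dlist l.
Proof. exact: flinE. Qed.

Lemma dL_cone v c : dL (cone v c) = c - cone v (dL c).
Proof.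
apply: (additive_eq (f := dL \o cone v) (g := idfun \- (cone v \o dL))) => l /=.
by rewrite coneU !dLU.
Qed.

Lemma dLdL c : dL (dL c) = 0.
Proof.
apply: (additive_eq (f := dL \o dL) (g := \0)) => l /=.
rewrite dLU; elim: l => [|v l IH] /=; first exact: raddf0.
by rewrite raddfB /= dL_cone dLU IH raddf0 subr0 subrr.
Qed.

Lemma dlist_allin l :
  allin (fun l' => size l = (size l').+1 /\ {subset l' <= l}) (dlist l).
Proof.
elim: l => [|v l IH] /=; first exact: allin0.
apply: allinB; first by apply: allinU; split => // u ul; rewrite inE ul orbT.
apply: allin_additive IH => l' [sl l'l] /=; rewrite coneU; apply: allinU.
by rewrite /= sl; split => // u; rewrite !inE => /orP[->//|/l'l ->]; rewrite orbT.
Qed.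

Variable bary : K -> seq K -> K.

(** Barycentric subdivision: the cone from the barycentre over the subdivided boundary. The number
    [k] bounds the recursion, as the faces in [dlist l] are not subterms of [l]; simplices are
    subdivided with [k] equal to their number of vertices. *)
Fixpoint sdlist (k : nat) (l : seq K) : fg (seq K) :=
  match k, l with
  | k'.+1, v :: l' => cone (bary v l') (flin (sdlist k' : _ -> L) (dlist l))
  | _, _ => << l >>
  end.

Definition sd k : fg (seq K) -> fg (seq K) :=
  flin (sdlist k : _ -> L).

HB.instance Definition _ k := GRing.Additive.on (sd k).

Lemma sd0 c : sd 0 c = c.
Proof.
by apply: (additive_eq (f := sd 0) (g := idfun)) => -[|v l] /=; rewrite /sd /= flinE.
Qed.

Lemma sd_cons k v l :
  sd k.+1 << v :: l >> = cone (bary v l) (sd k (dL << v :: l >>)).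
Proof. by rewrite /sd flinE /= dLU. Qed.

Lemma sd_nil k : sd k << [::] >> = << [::] >>.
Proof. by rewrite /sd flinE; case: k. Qed.

(** The cone formula leaves [sd k (dL l)] minus a cone over the boundary of that chain, which by
    induction is a subdivision of [dL (dL l) = 0]. The bound drops with the degree, so no condition
    on lengths is needed. *)
Lemma dL_sd k c : dL (sd k.+1 c) = sd k (dL c).
Proof.
elim: k c => [|k IH] c.
  apply: (additive_eq (f := dL \o sd 1) (g := sd 0 \o dL)) => -[|v l] /=.
    by rewrite sd_nil dLU /= raddf0.
  by rewrite sd_cons dL_cone !sd0 dLdL raddf0 subr0.
apply: (additive_eq (f := dL \o sd k.+2) (g := sd k.+1 \o dL)) => -[|v l] /=.
  by rewrite sd_nil dLU /= raddf0.
by rewrite sd_cons dL_cone IH dLdL !raddf0 ?addr0 ?subr0.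
Qed.

(** The classical chain homotopy T(l) = b (l - T(dl)) between the identity and subdivision, with b
    the barycentre of l. *)
Fixpoint sdhlist (k : nat) (l : seq K) : fg (seq K) :=
  match k, l with
  | k'.+1, v :: l' =>
      cone (bary v l') (<< l >> - flin (sdhlist k' : _ -> L) (dlist l))
  | _, _ => 0
  end.

Definition sdh k : fg (seq K) -> fg (seq K) :=
  flin (sdhlist k : _ -> L).

HB.instance Definition _ k := GRing.Additive.on (sdh k).

Lemma sdh0 c : sdh 0 c = 0.
Proof.
by apply: (additive_eq (f := sdh 0) (g := \0)) => -[|v l] /=; rewrite /sdh /= flinE.
Qed.

Lemma sdh_cons k v l : sdh k.+1 << v :: l >> =
  cone (bary v l) (<< v :: l >> - sdh k (dL << v :: l >>)).
Proof. by rewrite /sdh flinE /= dLU. Qed.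

Lemma sdh_nil k : sdh k << [::] >> = 0.
Proof. by rewrite /sdh flinE; case: k. Qed.

Lemma dL_sdh k c : dL (sdh k.+1 c) = c - sd k.+1 c - sdh k (dL c).
Proof.
elim: k c => [|k IH] c.
  apply: (additive_eq (f := dL \o sdh 1)
    (g := (idfun \- sd 1) \- (sdh 0 \o dL))) => -[|v l] /=.
    by rewrite sdh_nil sd_nil sdh0 raddf0 subrr subr0.
  by rewrite sdh_cons sd_cons dL_cone !sdh0 !sd0 !subr0.
apply: (additive_eq (f := dL \o sdh k.+2)
    (g := (idfun \- sd k.+2) \- (sdh k.+1 \o dL))) => -[|v l] /=.
  by rewrite sdh_nil sd_nil dLU /= !raddf0 subrr addr0.
rewrite sdh_cons sd_cons dL_cone.
(* The chain l - T(dl) under the cone has boundary sd(dl), by induction; coning that boundary gives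
   back sd(l). *)
have -> : dL (<< v :: l >> - sdh k.+1 (dL << v :: l >>)) =
    sd k.+1 (dL << v :: l >>).
  by rewrite raddfB /= IH dLdL raddf0 subr0 opprB addrC subrK.
by rewrite addrAC.
Qed.

End ListChains.

Section ListMap.
Variables K K' : choiceType.
Variable f : K -> K'.

Definition lmap : fg (seq K) -> fg (seq K') :=
  flin (fun l => << map f l >> : fg (seq K')).

HB.instance Definition _ := GRing.Additive.on lmap.

Lemma lmapU l : lmap << l >> = << map f l >>.
Proof. exact: flinE. Qed.

Lemma lmap_cone v c : lmap (cone v c) = cone (f v) (lmap c).
Proof.
apply: (additive_eq (f := lmap \o cone v) (g := cone (f v) \o lmap)) => l /=.
by rewrite coneU !lmapU coneU.
Qed.

Lemma lmap_dL c : lmap (dL c) = dL (lmap c).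
Proof.
apply: (additive_eq (f := lmap \o @dL K) (g := @dL K' \o lmap)) => l /=.
rewrite lmapU !dLU; elim: l => [|v l IH] /=; first exact: raddf0.
by rewrite raddfB /= lmapU lmap_cone IH.
Qed.

Variables (bary : K -> seq K -> K) (bary' : K' -> seq K' -> K').
Hypothesis fbary : forall v l, f (bary v l) = bary' (f v) (map f l).

Lemma lmap_sd k c : lmap (sd bary k c) = sd bary' k (lmap c).
Proof.
elim: k c => [|k IH] c; first by rewrite !sd0.
apply: (additive_eq (f := lmap \o sd bary k.+1) (g := sd bary' k.+1 \o lmap)).
case=> [|v l] /=; first by rewrite lmapU !sd_nil lmapU.
by rewrite lmapU /= !sd_cons lmap_cone IH lmap_dL lmapU fbary.
Qed.

Lemma lmap_sdh k c : lmap (sdh bary k c) = sdh bary' k (lmap c).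
Proof.
elim: k c => [|k IH] c; first by rewrite !sdh0 raddf0.
apply: (additive_eq (f := lmap \o sdh bary k.+1) (g := sdh bary' k.+1 \o lmap)).
case=> [|v l] /=; first by rewrite lmapU !sdh_nil raddf0.
by rewrite lmapU /= !sdh_cons lmap_cone raddfB /= IH lmap_dL lmapU fbary.
Qed.

End ListMap.

Section ListPrism.
Variables K K' : choiceType.
Variables i0 i1 : K -> K'.

(* Recursive form of the prism [\sum_i (-1)^i (v_0, ..., v_i, w_i, ..., w_n)], with
   [v] the copy of [l] under [i0] and [w] its copy under [i1]. *)
Fixpoint prlist (l : seq K) : fg (seq K') :=
  if l is v :: l' then
    << i0 v :: i1 v :: map i1 l' >> - cone (i0 v) (prlist l')
  else 0.

Definition pr : fg (seq K) -> fg (seq K') :=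
  flin (prlist : _ -> fg (seq K')).

HB.instance Definition _ := GRing.Additive.on pr.

Lemma prU l : pr << l >> = prlist l.
Proof. exact: flinE. Qed.

Lemma pr_cone v c :
  pr (cone v c) = cone (i0 v) (cone (i1 v) (lmap i1 c)) - cone (i0 v) (pr c).
Proof.
apply: (additive_eq (f := pr \o cone v)
  (g := (cone (i0 v) \o (cone (i1 v) \o lmap i1)) \- (cone (i0 v) \o pr))) => l /=.
by rewrite coneU lmapU !coneU !prU.
Qed.

Lemma dL_pr c : dL (pr c) = lmap i1 c - lmap i0 c - pr (dL c).
Proof.
apply: (additive_eq (f := @dL K' \o pr)
  (g := (lmap i1 \- lmap i0) \- (pr \o @dL K))) => l /=.
rewrite prU dLU !lmapU; elim: l => [|v l IH] /=.
  by rewrite !raddf0 subrr addr0.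
rewrite !raddfB /= dL_cone IH -(prU l) -(dLU l) pr_cone lmap_dL lmapU.
rewrite -!coneU dL_cone dL_cone !raddfB /=.
set a := cone (i1 v) _; set b := cone (i0 v) << map i1 l >>.
set c1 := cone (i0 v) _; set y := cone (i0 v) _; set q := cone (i0 v) _.
rewrite !opprK !addrA; congr (_ - q).
rewrite (addrAC a _ c1) (addrAC _ (- b) (- pr _)) subrK.
by rewrite (addrAC (a - y)) (addrAC a (- y)) addrAC.
Qed.

End ListPrism.

Lemma pr_lmap (K K' M M' : choiceType) (i0 i1 : K -> K') (j0 j1 : M -> M')
    (f : K -> M) (f' : K' -> M') c :
  (forall v, f' (i0 v) = j0 (f v)) -> (forall v, f' (i1 v) = j1 (f v)) ->
  pr j0 j1 (lmap f c) = lmap f' (pr i0 i1 c).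
Proof.
move=> f0 f1.
apply: (additive_eq (f := pr j0 j1 \o lmap f) (g := lmap f' \o pr i0 i1)) => l /=.
rewrite lmapU !prU; elim: l => [|v l IH] /=; first by rewrite raddf0.
rewrite raddfB /= lmapU lmap_cone IH /= f0 f1; congr (gen (_ :: _ :: _) - _).
by rewrite -!map_comp; apply: eq_map => u /=; rewrite f1.
Qed.

(** * Affine simplices *)

Lemma continuous_mx (R : realType) (T : topologicalType) (m n : nat)
    (g : T -> 'M[R]_(m, n)) :
  (forall i j, continuous (fun t => g t i j)) -> continuous g.
Proof.
move=> gc t A [P gP PA].
apply: (filterS (P := fun u => forall i j, P i j (g u i j))).
  by move=> u uP; apply: PA.
apply: filter_forall => i; apply: filter_forall => j.
exact: gc (gP i j).
Qed.

Section Coordinates.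
Variable R : realType.

Definition co n (x : simplex R n) (i : 'I_n.+1) : R := set_val x 0 i.

Lemma co_ge0 n (x : simplex R n) i : 0 <= co x i.
Proof. by have [+ _] := set_mem (valP x); apply. Qed.

Lemma co_sum n (x : simplex R n) : \sum_i co x i = 1.
Proof. by have [_ +] := set_mem (valP x). Qed.

Lemma co_inj n (x y : simplex R n) : (forall i, co x i = co y i) -> x = y.
Proof.
move=> xy; apply: val_inj; apply/rowP => i; exact: xy.
Qed.

Lemma co_coface n (x : simplex R n) i j :
  co (coface i x) j = if unlift i j is Some k then co x k else 0.
Proof. by rewrite /co /= mxE. Qed.

Lemma co_continuous n i : continuous (fun x : simplex R n => co x i).
Proof.
move=> x; apply: (@continuous_comp _ _ _ set_val (fun v : 'rV[R]_n.+1 => v 0 i)).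
  exact: initial_continuous.
exact: coord_continuous.
Qed.

Lemma mksimplex_subproof n (f : 'I_n.+1 -> R) (f0 : forall i, 0 <= f i)
  (f1 : \sum_i f i = 1) : \row_i f i \in simplex R n.
Proof.
rewrite inE; split=> [i|]; first by rewrite mxE.
by rewrite -[RHS]f1; apply: eq_bigr => i _; rewrite mxE.
Qed.

Definition mksimplex n (f : 'I_n.+1 -> R) (f0 : forall i, 0 <= f i)
  (f1 : \sum_i f i = 1) : simplex R n :=
  exist (fun v => v \in simplex R n) _ (mksimplex_subproof f0 f1).

Lemma co_mksimplex n (f : 'I_n.+1 -> R) f0 f1 i :
  co (@mksimplex n f f0 f1) i = f i.
Proof. by rewrite /co /= mxE. Qed.

Lemma continuous_simplex (T : topologicalType) n (g : T -> simplex R n) :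
  (forall i, continuous (fun t => co (g t) i)) -> continuous g.
Proof.
move=> gc; apply: continuous_comp_initial; apply: continuous_mx => i j.
by rewrite ord1; exact: gc.
Qed.

End Coordinates.

Lemma cts_pair (T U V : topologicalType) (f : T -> U) (g : T -> V) :
  continuous f -> continuous g -> continuous (fun t => (f t, g t)).
Proof. by move=> fc gc t; apply: cvg_pair; [exact: fc|exact: gc]. Qed.

Lemma cts_comp (T U V : topologicalType) (f : T -> U) (g : U -> V) :
  continuous f -> continuous g -> continuous (fun t => g (f t)).
Proof. by move=> fc gc t; apply: continuous_comp; [exact: fc|exact: gc]. Qed.

Section RealContinuity.
Variables (R : realType) (T : topologicalType).
Implicit Types f g : T -> R.

Lemma ctsD f g : continuous f -> continuous g -> continuous (fun t => f t + g t).
Proof. by move=> fc gc t; apply: cvgD; [exact: fc|exact: gc]. Qed.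

Lemma ctsB f g : continuous f -> continuous g -> continuous (fun t => f t - g t).
Proof. by move=> fc gc t; apply: cvgB; [exact: fc|exact: gc]. Qed.

Lemma ctsM f g : continuous f -> continuous g -> continuous (fun t => f t * g t).
Proof. by move=> fc gc t; apply: cvgM; [exact: fc|exact: gc]. Qed.

Lemma cts_min f g : continuous f -> continuous g ->
  continuous (fun t => Num.min (f t) (g t)).
Proof. by move=> fc gc t; apply: continuous_min; [exact: fc|exact: gc]. Qed.

Lemma cts_max f g : continuous f -> continuous g ->
  continuous (fun t => Num.max (f t) (g t)).
Proof. by move=> fc gc t; apply: continuous_max; [exact: fc|exact: gc]. Qed.

End RealContinuity.

Lemma continuous_bigsum (R : realType) (T : topologicalType) (I : finType)
    (f : I -> T -> R) :
  (forall i, continuous (f i)) -> continuous (fun t => \sum_i f i t).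
Proof.
by move=> fc t; apply: cvg_big => [|i _]; [exact: add_continuous|exact: fc].
Qed.

(** * Convex spaces, affine maps and barycentres *)

Section ConvexSpaces.
Variable R : realType.

Lemma scomb_sum n m (w : 'I_n.+1 -> simplex R m) (x : simplex R n) :
  \sum_j \sum_i co x i * co (w i) j = 1.
Proof.
rewrite exchange_big /= -[RHS](co_sum x); apply: eq_bigr => i _.
by rewrite -mulr_sumr co_sum mulr1.
Qed.

Definition scomb m n (w : 'I_n.+1 -> simplex R m) (x : simplex R n) : simplex R m :=
  @mksimplex R m (fun j => \sum_i co x i * co (w i) j)
    (fun j => sumr_ge0 _ (fun i _ => mulr_ge0 (co_ge0 x i) (co_ge0 (w i) j)))
    (scomb_sum w x).

Lemma co_scomb m n (w : 'I_n.+1 -> simplex R m) x j :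
  co (scomb w x) j = \sum_i co x i * co (w i) j.
Proof. exact: co_mksimplex. Qed.

(* [comb w x] plays the role of [\sum_i x_i w_i]. *)
Record convex := Convex {
  convex_sort :> topologicalType;
  comb : forall n, ('I_n.+1 -> convex_sort) -> simplex R n -> convex_sort;
  comb_continuous : forall n (w : 'I_n.+1 -> convex_sort), continuous (comb w);
  comb_coface : forall n (w : 'I_n.+2 -> convex_sort) i x,
    comb w (coface i x) = comb (w \o lift i) x;
  comb_scomb : forall m n (w : 'I_m.+1 -> convex_sort) (w' : 'I_n.+1 -> simplex R m) x,
    comb w (scomb w' x) = comb (fun i => comb w (w' i)) x }.

Lemma sum_coface n (x : simplex R n) (i : 'I_n.+2) (f : 'I_n.+2 -> R) :
  \sum_j co (coface i x) j * f j = \sum_j co x j * f (lift i j).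
Proof.
rewrite (bigD1_ord i) //= co_coface unlift_none mul0r add0r.
by apply: eq_bigr => j _; rewrite co_coface liftK.
Qed.

Lemma sum_scomb m n (w : 'I_n.+1 -> simplex R m) x (f : 'I_m.+1 -> R) :
  \sum_j co (scomb w x) j * f j = \sum_i co x i * \sum_j co (w i) j * f j.
Proof.
under eq_bigr do rewrite co_scomb mulr_suml.
rewrite exchange_big; apply: eq_bigr => i _.
by rewrite mulr_sumr; apply: eq_bigr => j _; rewrite mulrA.
Qed.

Lemma wsum_continuous n (f : 'I_n.+1 -> R) :
  continuous (fun x : simplex R n => \sum_i co x i * f i).
Proof.
apply: continuous_bigsum => i.
by apply: ctsM; [exact: co_continuous|exact: cst_continuous].
Qed.

Definition simplexC (m : nat) : convex.
Proof.
refine (@Convex (simplex R m) (@scomb m) _ _ _) => [n w|n w i x|m' n w w' x].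
- apply: continuous_simplex => j.
  under [X in continuous X]eq_fun do rewrite co_scomb.
  exact: wsum_continuous.
- by apply: co_inj => j; rewrite !co_scomb sum_coface.
- apply: co_inj => j; rewrite !co_scomb sum_scomb.
  by apply: eq_bigr => i _; rewrite co_scomb.
Defined.

Definition lineC : convex.
Proof.
refine (@Convex R (fun n w x => \sum_i co x i * w i) _ _ _) => [n w|n w i x|m' n w w' x].
- exact: wsum_continuous.
- by rewrite sum_coface.
- by rewrite sum_scomb.
Defined.

Definition prodC (K K' : convex) : convex.
Proof.
refine (@Convex (K * K')%type
  (fun n w x => (comb (fst \o w) x, comb (snd \o w) x)) _ _ _)
  => [n w|n w i x|m' n w w' x].
- by apply: cts_pair; exact: comb_continuous.
- by rewrite !comb_coface.
- by rewrite !comb_scomb.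
Defined.

Definition affine (K K' : convex) (f : K -> K') :=
  forall n (w : 'I_n.+1 -> K) x, f (comb w x) = comb (f \o w) x.

Lemma comb_affine (K : convex) m (w : 'I_m.+1 -> K) :
  affine (comb w : simplexC m -> K).
Proof. by move=> n w' x; exact: comb_scomb. Qed.

Lemma coface_affine n (i : 'I_n.+2) :
  affine (@coface R n i : simplexC n -> simplexC n.+1).
Proof.
move=> m w x; apply: co_inj => j; rewrite co_coface co_scomb.
case: unliftP => [k|] ->; rewrite ?co_scomb.
  by apply: eq_bigr => l _; rewrite co_coface liftK.
by rewrite big1 // => l _; rewrite co_coface unlift_none mulr0.
Qed.

Definition vtx n (i : 'I_n.+1) : simplex R n.
Proof.
refine (@mksimplex R n (fun j => (i == j)%:R) (fun j => ler0n _ _) _).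
rewrite (bigD1 i) //= eqxx big1 ?addr0 // => j /negbTE.
by rewrite eq_sym => ->.
Defined.

Lemma co_vtx n (i j : 'I_n.+1) : co (vtx i) j = (i == j)%:R.
Proof. exact: co_mksimplex. Qed.

Lemma comb_vtx n (x : simplex R n) : comb (@vtx n : _ -> simplexC n) x = x.
Proof.
apply: co_inj => j; rewrite co_scomb (bigD1 j) //= co_vtx eqxx mulr1.
by rewrite big1 ?addr0 // => i /negbTE ij; rewrite co_vtx ij mulr0.
Qed.

Lemma coface_vtx n (i : 'I_n.+2) (j : 'I_n.+1) : coface i (vtx j) = vtx (lift i j).
Proof.
apply: co_inj => k; rewrite co_coface co_vtx.
case: unliftP => [l|] ->; first by rewrite co_vtx (inj_eq lift_inj).
by rewrite eq_sym (negbTE (neq_lift _ _)).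
Qed.

Definition unif n : simplex R n.
Proof.
refine (@mksimplex R n (fun j => n.+1%:R^-1) (fun j => _) _).
  by rewrite invr_ge0.
by rewrite sumr_const card_ord -[LHS]mulr_natr mulVf ?pnatr_eq0.
Defined.

Lemma co_unif n i : co (unif n) i = n.+1%:R^-1.
Proof. exact: co_mksimplex. Qed.

Definition bary (K : convex) (v : K) (l : seq K) : K :=
  comb (fun i : 'I_(size l).+1 => nth v (v :: l) i) (unif (size l)).

Lemma affine_bary (K K' : convex) (f : K -> K') : affine f ->
  forall v l, f (bary v l) = bary (f v) (map f l).
Proof.
move=> fa v l; rewrite /bary size_map fa; congr comb; apply/funext => i /=.
by rewrite -map_cons (nth_map v)//=.
Qed.

End ConvexSpaces.

Section Lists.
Variable K : choiceType.

Definition lst n (w : 'I_n -> K) : seq K := [seq w i | i <- enum 'I_n].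

Lemma size_lst n (w : 'I_n -> K) : size (lst w) = n.
Proof. by rewrite size_map size_enum_ord. Qed.

Lemma nth_lst n (w : 'I_n -> K) v (i : 'I_n) : nth v (lst w) i = w i.
Proof. by rewrite (nth_map i) ?size_enum_ord// nth_ord_enum. Qed.

Lemma lst_nth v l : l = lst (fun i : 'I_(size l) => nth v l i).
Proof.
apply: (@eq_from_nth _ v) => [|i il]; first by rewrite size_lst.
by rewrite -[i]/(nat_of_ord (Ordinal il)) nth_lst.
Qed.

Lemma lst_exists n l : size l = n.+1 -> exists w : 'I_n.+1 -> K, l = lst w.
Proof. by case: l => // v l <-; eexists; exact: (lst_nth v). Qed.

Lemma lst_cons n (w : 'I_n.+1 -> K) : lst w = w ord0 :: lst (w \o lift ord0).
Proof. by rewrite /lst enum_ordSl /= -map_comp. Qed.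

Lemma additive_scale (U V : lmodType int) (f : {additive U -> V}) (k : int) u :
  f (k *: u) = k *: f u.
Proof. by rewrite -[k]intz !scaler_int raddfMz. Qed.

(** Links the recursive boundary, suited to cones, with the alternating sum that defines [boundary]:
    the face opposite the first vertex is the tail, and the other faces are cones over the faces of
    the tail. *)
Lemma dL_lst n (w : 'I_n.+1 -> K) :
  dL (gen (lst w)) = \sum_(i < n.+1) (-1) ^+ i *: gen (lst (w \o lift i)).
Proof.
elim: n w => [|n IH] w; rewrite lst_cons dLU /= big_ord_recl scale1r -dLU.
  (* The only face of a single vertex is the empty list, the generator in degree -1. *)
  by rewrite [lst _]size0nil ?size_lst// dLU /= raddf0 subr0 big_ord0 addr0.
congr (_ + _); rewrite IH raddf_sum /= -sumrN; apply: eq_bigr => i _.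
rewrite additive_scale /= coneU exprS mulN1r scaleNr; congr (- (_ *: gen _)).
rewrite [RHS]lst_cons /=; congr (_ :: _).
  by congr w; apply/val_inj.
congr lst; apply/funext => j /=; congr w; apply/val_inj => /=.
by rewrite /bump /= !add1n ltnS addnS.
Qed.

End Lists.

Lemma lmap_lst (K K' : choiceType) (f : K -> K') n (w : 'I_n -> K) :
  lmap f (gen (lst w)) = gen (lst (f \o w)).
Proof. by rewrite lmapU /lst -map_comp. Qed.

(** * From lists of points to singular chains *)

Section Evaluation.
Variables (R : realType) (X : topologicalType).
Local Notation C n := (chain R X n).

HB.instance Definition _ n :=
  GRing.isZmodMorphism.Build (C n.+1) (C n) (@boundary R X n)
    (@boundary_is_additive R X n).

Definition sing n (f : simplex R n -> X) (fc : continuous f) : singular R X n :=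
  mkcts fc.

Lemma singE n (f : simplex R n -> X) (fc : continuous f) x : sing fc x = f x.
Proof. by []. Qed.

Lemma boundaryU n (s : singular R X n.+1) :
  boundary (gen s : C n.+1) = \sum_(i < n.+2) (-1) ^+ i *: (gen (face i s) : C n).
Proof. by rewrite /boundary liftU scale1r. Qed.

Section Convex.
Variables (K : convex R) (s : continuousType K X).

Lemma affsing_continuous n (w : 'I_n.+1 -> K) : continuous (s \o comb w).
Proof. by apply: cts_comp; [exact: comb_continuous|exact: cts_fun]. Qed.

Definition affsing n (w : 'I_n.+1 -> K) : singular R X n :=
  sing (affsing_continuous (w := w)).

(* Lists of the wrong length are sent to [0]. *)
Definition ev n : fg (seq K) -> C n :=
  flin (fun l => if l is v :: l' then
    if size l' == n then
      gen (affsing (fun i : 'I_n.+1 => nth v l i)) : C n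
    else 0 else 0).

HB.instance Definition _ n := GRing.Additive.on (ev n).

Lemma ev_neq n l : size l != n.+1 -> ev n << l >> = 0.
Proof. by rewrite /ev flinE; case: l => //= v l /negbTE; rewrite eqSS => ->. Qed.

Lemma ev_lst n (w : 'I_n.+1 -> K) : ev n << lst w >> = gen (affsing w).
Proof.
rewrite /ev flinE {1}lst_cons size_lst eqxx; congr gen; congr affsing.
by apply/funext => i; rewrite nth_lst.
Qed.

Lemma face_affsing n (w : 'I_n.+2 -> K) i :
  face i (affsing w) = affsing (w \o lift i).
Proof. by apply/continuousEP => x /=; rewrite !singE /= -comb_coface. Qed.

Lemma boundary_ev n c : boundary (ev n.+1 c) = ev n (dL c).
Proof.
apply: (additive_eq (f := @boundary R X n \o ev n.+1) (g := ev n \o @dL K)) => l /=.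
have [/lst_exists[w ->]|sl] := eqVneq (size l) n.+2.
  rewrite ev_lst boundaryU dL_lst raddf_sum; apply: eq_bigr => i _.
  by rewrite additive_scale /= ev_lst face_affsing.
(* A list of the wrong length goes to 0 on both sides, since its faces, one point shorter, have the
   wrong length in the degree below. *)
rewrite ev_neq // raddf0; symmetry.
apply: (additive_eq_in (f := ev n) (g := \0) _ (c := dL << l >>)
  (P := fun l' => size l = (size l').+1)).
  by move=> l' sl'; apply: ev_neq; rewrite -eqSS -sl'.
by rewrite dLU; apply: allin_imp (@dlist_allin _ l) => l' [].
Qed.

Lemma ev_range n c (A : set X) : (forall x, A (s x)) ->
  allin (fun t : singular R X n => range t `<=` A) (ev n c).
Proof.
move=> sA; apply: (@allin_additive _ _ (fun=> True)) => // l _ /=.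
have [/lst_exists[w ->]|sl] := eqVneq (size l) n.+1.
  by rewrite ev_lst; apply: allinU => _ [x _ <-]; exact: sA.
by rewrite ev_neq //; exact: allin0.
Qed.

End Convex.

Lemma ev_lmap (K K' : convex R) (f : K -> K') (fc : continuous f)
    (s : continuousType K' X) (t : continuousType K X) n c :
  affine f -> (forall v, t v = s (f v)) -> ev t n c = ev s n (lmap f c).
Proof.
move=> fa ts.
apply: (additive_eq (f := ev t n) (g := ev s n \o lmap f)) => l /=.
have [/lst_exists[w ->]|sl] := eqVneq (size l) n.+1; last first.
  by rewrite lmapU !ev_neq ?size_map.
rewrite lmap_lst !ev_lst; congr gen; apply/continuousEP => x.
by rewrite !singE /= ts fa.
Qed.

Definition vl n : fg (seq (simplex R n)) := << lst (@vtx R n) >>.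

Lemma ev_vl n (s : singular R X n) : ev (K := simplexC R n) s n (vl n) = gen s.
Proof.
rewrite (@ev_lst (simplexC R n)); congr gen; apply/continuousEP => x.
exact: (congr1 s (comb_vtx x)).
Qed.

Lemma dL_vl n :
  dL (vl n.+1) = \sum_(i < n.+2) (-1) ^+ i *: lmap (@coface R n i) (vl n).
Proof.
rewrite dL_lst; apply: eq_bigr => i _; rewrite lmap_lst; congr (_ *: gen (lst _)).
by apply/funext => j /=; rewrite coface_vtx.
Qed.

(** The natural operator fixed by its value [v] on the universal simplex: a singular simplex [s]
    carries [v] along. Operators on all singular chains are thereby built inside one standard
    simplex. *)
Definition natop n m (v : fg (seq (simplex R n))) : C n -> C m :=
  flin (fun s : singular R X n => ev (K := simplexC R n) s m v).

HB.instance Definition _ n m v := GRing.Additive.on (@natop n m v).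

Lemma natopU n m v s : @natop n m v (gen s) = ev (K := simplexC R n) s m v.
Proof. exact: flinE. Qed.

End Evaluation.

(** * Subdivision of singular chains *)

Section Operators.
Variable R : realType.
Implicit Types X Y : topologicalType.

(** If [Q] is natural for the cofaces, its value on the boundary of the universal simplex is
    computed face by face. This turns an identity between lists into one between natural operators,
    for subdivision and for its homotopy alike. *)
Lemma ev_dvl X n m (Q : {additive fg (seq (simplex R n.+1)) -> fg (seq (simplex R n.+1))})
    (v : fg (seq (simplex R n))) (s : singular R X n.+1) :
  (forall i, Q (lmap (@coface R n i) (vl R n)) = lmap (coface i) v) ->
  ev (K := simplexC R n.+1) s m (Q (dL (vl R n.+1))) =
    natop m v (boundary (gen s : chain R X n.+1)).
Proof.
move=> Qv; rewrite dL_vl boundaryU !raddf_sum; apply: eq_bigr => i _.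
rewrite !additive_scale /= Qv natopU; congr (_ *: _); symmetry.
by apply: ev_lmap => //; [exact: coface_continuous|exact: coface_affine].
Qed.

Lemma sd_affine (K K' : convex R) (f : K -> K') k c : affine f ->
  sd (@bary R K') k (lmap f c) = lmap f (sd (@bary R K) k c).
Proof. by move=> fa; rewrite (lmap_sd (affine_bary fa)). Qed.

Lemma sdh_affine (K K' : convex R) (f : K -> K') k c : affine f ->
  sdh (@bary R K') k (lmap f c) = lmap f (sdh (@bary R K) k c).
Proof. by move=> fa; rewrite (lmap_sdh (affine_bary fa)). Qed.

Lemma comb_at_vtx m n (w : 'I_n.+1 -> simplexC R m) i : comb w (vtx R i) = w i.
Proof.
apply: co_inj => j; rewrite co_scomb (bigD1 i) //= co_vtx eqxx mul1r.
by rewrite big1 ?addr0 // => k; rewrite co_vtx eq_sym => /negbTE ->; rewrite mul0r.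
Qed.

Definition supp X n (A : set X) : chain R X n -> Prop :=
  allin (fun s : singular R X n => range s `<=` A).

Lemma supp_boundary X n (A : set X) (c : chain R X n.+1) :
  supp A c -> supp A (boundary c).
Proof.
apply: allin_additive => s sA /=; rewrite boundaryU; apply: allin_sum => i.
rewrite -[_ ^+ i]intz scaler_int; apply: allinMz; apply: allinU.
by move=> _ [x _ <-]; apply: sA; exists (coface i x).
Qed.

Section Subdivision.
Variable X : topologicalType.
Local Notation C n := (chain R X n).

Local Notation baryS n := (@bary R (simplexC R n)).

Definition subdiv n : C n -> C n := natop n (sd (baryS n) n.+1 (vl R n)).
Definition subdivh n : C n -> C n.+1 := natop n.+1 (sdh (baryS n) n.+1 (vl R n)).

HB.instance Definition _ n := GRing.Additive.on (@subdiv n).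
HB.instance Definition _ n := GRing.Additive.on (@subdivh n).

Lemma boundary_subdiv n (c : C n.+1) :
  boundary (subdiv c) = subdiv (boundary c).
Proof.
apply: (additive_eq (f := @boundary R X n \o @subdiv n.+1)
  (g := @subdiv n \o @boundary R X n)) => s /=.
rewrite {1}/subdiv natopU boundary_ev dL_sd; apply: ev_dvl => i /=.
exact: sd_affine (@coface_affine _ _ _).
Qed.

Lemma boundary_subdivh n (c : C n.+1) :
  boundary (subdivh c) = c - subdiv c - subdivh (boundary c).
Proof.
apply: (additive_eq (f := @boundary R X n.+1 \o @subdivh n.+1)
  (g := (idfun \- @subdiv n.+1) \- (@subdivh n \o @boundary R X n))) => s /=.
rewrite {1}/subdivh natopU boundary_ev dL_sdh !raddfB /= ev_vl.
congr (_ - _ - _); first by rewrite /subdiv natopU.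
apply: ev_dvl => i /=.
exact: sdh_affine (@coface_affine _ _ _).
Qed.

Lemma boundary_subdivh0 (c : C 0) : boundary (subdivh c) = c - subdiv c.
Proof.
apply: (additive_eq (f := @boundary R X 0 \o @subdivh 0)
  (g := idfun \- @subdiv 0)) => s /=.
rewrite {1}/subdivh natopU boundary_ev dL_sdh sdh0 subr0 raddfB /= ev_vl.
by rewrite /subdiv natopU.
Qed.

Lemma supp_subdiv n A (c : C n) : supp A c -> supp A (subdiv c).
Proof.
apply: allin_additive => s sA /=; rewrite /subdiv natopU.
by apply: ev_range => x; apply: sA; exists x.
Qed.

Lemma supp_subdivh n A (c : C n) : supp A c -> supp A (subdivh c).
Proof.
apply: allin_additive => s sA /=; rewrite /subdivh natopU.
by apply: ev_range => x; apply: sA; exists x.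
Qed.

(** Allows subdivision to be iterated on lists of points of a standard simplex, where distances can
    be measured. The affine simplex with vertices [w] carries the subdivided universal simplex to
    the subdivision of [lst w]. *)
Lemma subdiv_ev n m (s : continuousType (simplex R m) X) c :
  allin (fun l => size l = n.+1) c ->
  subdiv (ev (K := simplexC R m) s n c) =
    ev (K := simplexC R m) s n (sd (baryS m) n.+1 c).
Proof.
apply: (additive_eq_in (f := @subdiv n \o ev (K := simplexC R m) s n)
  (g := ev (K := simplexC R m) s n \o sd (baryS m) n.+1)) => l sl /=.
have [w ->] := lst_exists sl.
rewrite ev_lst /subdiv natopU.
rewrite (ev_lmap (K := simplexC R n) (K' := simplexC R m) (f := comb w) _ (s := s)) //.
- rewrite -(sd_affine _ _ (@comb_affine R (simplexC R m) n w)).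
  congr (ev _ _ (sd _ _ _)); rewrite lmap_lst; congr (gen (lst _)).
  by apply/funext => i /=; exact: comb_at_vtx.
- exact: comb_continuous.
- exact: comb_affine.
Qed.

End Subdivision.
End Operators.

(** * Subdivision makes chains small *)

Lemma compact_set_type (T : topologicalType) (A : set T) :
  compact A -> compact [set: A].
Proof.
move=> cA; have [[a Aa]|A0] := pselect (exists a, A a); last first.
  suff -> : [set: A] = set0 by exact: compact0.
  by apply/seteqP; split => // -[a Aa] _; apply: A0; exists a; exact: set_mem.
(* A left inverse of the inclusion, constant off [A]; only its continuity on [A] matters. *)
pose f (t : T) : A := insubd (exist (fun t => t \in A) a (mem_set Aa)) t.
have fK (x : A) : f (set_val x) = x by rewrite /f set_valE valKd.
have -> : [set: A] = f @` A.
  apply/seteqP; split => // x _; exists (set_val x); [exact: set_valP|exact: fK].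
apply: continuous_compact cA; apply/subspace_sigL_continuousP.
rewrite (_ : sigL A f = id) //; first by move=> x.
by apply/funext => x; exact: fK.
Qed.

Section SimplexCompact.
Variable R : realType.

Lemma co_le1 n (x : simplex R n) i : co x i <= 1.
Proof.
rewrite -(co_sum x) (bigD1 i) //= lerDl; apply: sumr_ge0 => j _; exact: co_ge0.
Qed.

Lemma simplex_compact n : compact [set: simplex R n].
Proof.
apply: compact_set_type; rewrite (_ : simplex R n =
  [set v : 'rV[R]_n.+1 | forall i, 0 <= v 0 i <= 1] `&`
  [set v | \sum_i v 0 i = 1]).
  apply: compact_closedI.
    exact: (@rV_compact R n.+1 (fun=> `[0, 1]%classic) (fun=> @segment_compact R 0 1)).
  apply: (@closed_comp _ _ (fun v : 'rV[R]_n.+1 => \sum_i v 0 i) [set 1]);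
    last exact: closed_eq.
  by move=> v _; apply: continuous_bigsum => i; exact: coord_continuous.
apply/seteqP; split => v [v0 v1]; split => // i; last first.
  by have /andP[] := v0 i.
rewrite v0 /= -v1 (bigD1 i) //= lerDl.
by apply: sumr_ge0.
Qed.

Lemma simplex_nbhs n (x : simplex R n) (B : set (simplex R n)) : nbhs x B ->
  exists2 e, 0 < e & forall y, (forall j, `|co x j - co y j| < e) -> B y.
Proof.
move=> /nbhs_ballP[e e0 eB]; exists e => // y xy; apply: eB; split => // i j.
by rewrite ord1; exact: xy.
Qed.

(** Heine-Cantor for the coordinatewise distance. Radii tending to 0 from the right serve as the
    filter that compactness makes uniform in the point. *)
Lemma simplex_uniform n (g : simplex R n -> R) (e : R) : continuous g -> 0 < e ->
  exists2 d, 0 < d & forall x y, (forall j, `|co x j - co y j| < d) -> `|g x - g y| < e.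
Proof.
move=> gc e0; have /compact_near_coveringP cov := @simplex_compact n.
pose P (d : R) (x : simplex R n) :=
  forall y, (forall j, `|co x j - co y j| < d) -> `|g x - g y| < e.
have cvr x : [set: simplex R n] x -> \forall x' \near x & d \near 0^'+, P d x'.
  move=> _.
  have [d d0 dP] : exists2 d, 0 < d & forall y,
      (forall j, `|co x j - co y j| < d) -> `|g x - g y| < e / 2.
    apply: simplex_nbhs; apply: (gc x [set r | `|g x - r| < e / 2]).
    by apply/nbhs_ballP; exists (e / 2) => //=; exact: divr_gt0.
  (* Half of the radius is spent between [x] and [x'], the other half between [x'] and [y]; both
     [x'] and [y] are then within [d] of [x], and each comparison with [g x] costs [e / 2]. *)
  exists ([set x' | forall j, `|co x j - co x' j| < d / 2], [set d' | d' < d / 2]).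
    split => /=; last by apply: nbhs_right_lt; exact: divr_gt0.
    apply/nbhs_ballP; exists (d / 2); first exact: divr_gt0.
    by move=> y [_ xy] j; have := xy ord0 j.
  move=> [x' d'] /= [xx' d'd] y x'y.
  have -> : g x' - g y = (g x - g y) - (g x - g x') by ring.
  rewrite (splitr e) (le_lt_trans (ler_normB _ _)) // ltrD //; apply: dP => j.
    have -> : co x j - co y j = (co x j - co x' j) + (co x' j - co y j) by ring.
    rewrite (splitr d) (le_lt_trans (ler_normD _ _)) // ltrD //.
    by apply: lt_trans d'd; exact: x'y.
  by apply: lt_le_trans (xx' j) _; lra.
have dP := cov _ _ _ (@at_right_proper_filter R 0) cvr.
have [d [{}dP d0]] := @filter_ex _ _ (at_right_proper_filter 0) _
  (@filterI _ _ (@at_right_proper_filter R 0) _ _ dP (@nbhs_right_gt R 0)).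
by exists d => // x y; exact: dP.
Qed.

End SimplexCompact.

Section Mesh.
Variables (R : realType) (m : nat).
Local Notation S := (simplex R m).
Implicit Types (u v z : S) (l : seq S) (r : R).

Definition near_list r z l := forall v, v \in l -> forall j, `|co z j - co v j| <= r.
Definition mesh r l := forall u, u \in l -> near_list r u l.

Lemma co_bary v l j :
  co (@bary R (simplexC R m) v l) j =
  \sum_(i < (size l).+1) (size l).+1%:R^-1 * co (nth v (v :: l) i) j.
Proof. by rewrite co_scomb; apply: eq_bigr => i _; rewrite co_unif; reflexivity. Qed.

Lemma sum_inv n (c : R) : c = \sum_(i < n.+1) n.+1%:R^-1 * c.
Proof.
rewrite -mulr_suml -[LHS]mul1r -[X in X * c = _](co_sum (unif R n)).
by congr (_ * _); apply: eq_bigr => i _; rewrite co_unif.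
Qed.

Lemma co_sub_bary z v l j : co z j - co (@bary R (simplexC R m) v l) j =
  \sum_(i < (size l).+1)
    (size l).+1%:R^-1 * (co z j - co (nth v (v :: l) i) j).
Proof.
rewrite co_bary [X in X - _](sum_inv (size l)) -sumrB.
by apply: eq_bigr => i _; rewrite mulrBr.
Qed.

Lemma near_list_bary r z v l : near_list r z (v :: l) ->
  forall j, `|co z j - co (@bary R (simplexC R m) v l) j| <= r.
Proof.
move=> zl j; rewrite co_sub_bary; apply: le_trans (ler_norm_sum _ _ _) _.
rewrite [leRHS](sum_inv (size l)); apply: ler_sum => i _.
rewrite normrM ger0_norm ?invr_ge0// ler_wpM2l ?invr_ge0//.
by apply: zl; rewrite mem_nth.
Qed.

(** In the average of the differences between [u] and the vertices, the term of [u] itself vanishes;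
    of the N equal weights 1/N, only N - 1 are left, each on a difference at most [r]. *)
Lemma mesh_bary r v l u : mesh r (v :: l) -> u \in v :: l ->
  forall j, `|co u j - co (@bary R (simplexC R m) v l) j| <=
            (1 - (size l).+1%:R^-1) * r.
Proof.
move=> ml ul j; rewrite co_sub_bary; apply: le_trans (ler_norm_sum _ _ _) _.
have iu : (index u (v :: l) < (size l).+1)%N by rewrite -index_mem in ul.
rewrite (bigD1 (Ordinal iu)) //= nth_index // subrr mulr0 normr0 add0r.
rewrite mulrBl mul1r {1}[r](sum_inv (size l)).
rewrite [leRHS](_ : _ = \sum_(i < (size l).+1 | i != Ordinal iu)
    (size l).+1%:R^-1 * r); last first.
  by rewrite (bigD1 (Ordinal iu)) //= addrAC subrr add0r.
apply: ler_sum => i _.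
rewrite normrM ger0_norm ?invr_ge0// ler_wpM2l ?invr_ge0//.
by apply: ml => //; rewrite mem_nth.
Qed.

(* The second clause replaces membership in the convex hull of [l]: every ball
   containing [l] contains [l']. *)
Lemma sd_mesh k l : size l = k ->
  allin (fun l' => [/\ size l' = k,
      forall z r, near_list r z l -> near_list r z l' &
      forall r, 0 <= r -> mesh r l -> mesh ((1 - k%:R^-1) * r) l'])
    (sd (@bary R (simplexC R m)) k << l >>).
Proof.
elim: k l => [|k IH] [|v l] //=.
  by move=> _; rewrite sd_nil; apply: allinU.
move=> [sl]; rewrite sd_cons dLU.
apply: (@allin_additive _ _ _ _ (cone _ \o sd _ k) _ _ (@dlist_allin _ (v :: l))).
move=> l1 /= [[sl1] sub1]; rewrite sl in sl1.
apply: allin_additive (IH l1 (esym sl1)) => l2 [sl2 wl2 ml2] /=.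
rewrite coneU; apply: allinU.
have sub r z : near_list r z (v :: l) -> near_list r z l1 by move=> H u /sub1; exact: H.
split=> [|z r zl|r r0 ml]; first by rewrite /= sl2.
  move=> u; rewrite inE => /orP[/eqP ->|]; first exact: near_list_bary.
  by apply: wl2; exact: sub.
have bl2 : near_list ((1 - k.+1%:R^-1) * r) (@bary R (simplexC R m) v l) l2.
  apply: wl2; apply: sub => u ul j; rewrite distrC -sl; exact: mesh_bary.
have q0 : 0 <= (1 - k.+1%:R^-1) * r.
  by rewrite mulr_ge0 // subr_ge0 invf_le1 // ler1n.
have ml1 : mesh ((1 - k%:R^-1) * r) l2.
  by apply: ml2 => // u /sub1 ul; apply: sub; exact: ml.
move=> u; rewrite inE => /orP[/eqP -> w|ul2 w].
  by rewrite inE => /orP[/eqP -> j|]; [rewrite subrr normr0|exact: bl2].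
rewrite inE => /orP[/eqP -> j|wl j]; first by rewrite distrC; exact: bl2.
(* Two vertices of a subdivided face are within (1 - 1/k) r by induction, and this factor grows with
   k; k is positive because [l2] is not empty. *)
apply: le_trans (ml1 u ul2 w wl j) _; rewrite ler_wpM2r // lerD2l lerN2.
have k0 : (0 < k)%N by rewrite -sl2; case: (l2) wl.
by rewrite lef_pV2 ?posrE ?ltr0n // ler_nat.
Qed.

End Mesh.

Section Small.
Variable R : realType.

Lemma mesh_vl n : allin (fun l => size l = n.+1 /\ mesh 1 l) (vl R n).
Proof.
apply: allinU; rewrite size_lst; split => // u _ v _ j.
have := co_ge0 u j; have := co_ge0 v j; have := co_le1 u j; have := co_le1 v j.
by move=> *; rewrite ler_norml; lra.
Qed.

Local Notation q n := (1 - n.+1%:R^-1 : R).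

Lemma q_ge0 n : 0 <= q n.
Proof. by rewrite subr_ge0 invf_le1 // ler1n. Qed.

Definition isd n k := iter k (sd (@bary R (simplexC R n)) n.+1) (vl R n).

Lemma mesh_isd n k :
  allin (fun l => size l = n.+1 /\ mesh (q n ^+ k) l) (isd n k).
Proof.
elim: k => [|k IH]; first by rewrite expr0; exact: mesh_vl.
apply: allin_additive IH => l [sl ml] /=.
apply: allin_imp (sd_mesh sl) => l' [-> _ H]; split => //.
by rewrite exprS; apply: H => //; rewrite exprn_ge0 // q_ge0.
Qed.

Variable X : topologicalType.

Lemma iter_subdiv_ev n k (s : singular R X n) :
  iter k (@subdiv R X n) (gen s) = ev (K := simplexC R n) s n (isd n k).
Proof.
elim: k => [|k IH]; first by rewrite ev_vl.
rewrite iterS IH subdiv_ev //.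
by apply: allin_imp (@mesh_isd n k) => l [].
Qed.

Definition osc (g : X -> R) (e : R) n (t : singular R X n) :=
  forall x y, `|g (t x) - g (t y)| < e.

Lemma osc_subdiv g e n (c : chain R X n) :
  allin (osc g e (n := n)) c -> allin (osc g e (n := n)) (subdiv c).
Proof.
apply: allin_additive => s sg /=; rewrite /subdiv natopU.
have sr : forall x, range s (s x) by move=> x; exists x.
apply: allin_imp (@ev_range _ _ (simplexC R n) s _ _ _ sr) => t ts x y.
have [x' _ <-] := ts _ (imageT t x); have [y' _ <-] := ts _ (imageT t y).
exact: sg.
Qed.

Lemma osc_iter_subdiv g e n k (c : chain R X n) : allin (osc g e (n := n)) c ->
  allin (osc g e (n := n)) (iter k (@subdiv R X n) c).
Proof. by move=> gc; elim: k => //= k IH; exact: osc_subdiv. Qed.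

Lemma simplex_small n (s : singular R X n) g e : continuous g -> 0 < e ->
  exists k, allin (osc g e (n := n)) (iter k (@subdiv R X n) (gen s)).
Proof.
move=> gc e0.
have [d d0 dP] := simplex_uniform (cts_comp (@cts_fun _ _ s) gc) e0.
have d20 : 0 < d / 2 by rewrite divr_gt0.
have [k kd] : exists k, q n ^+ k < d / 2.
  have q1 : `|q n| < 1.
    by rewrite ger0_norm ?q_ge0 // ltrBlDr ltrDl invr_gt0.
  have := cvg_expr q1; move=> /cvgrPdist_lt /(_ _ d20)[k _ kP].
  exists k; have := kP k (leqnn k).
  by rewrite sub0r normrN ger0_norm // exprn_ge0 // q_ge0.
exists k; rewrite iter_subdiv_ev.
apply: (allin_additive (f := ev (K := simplexC R n) s n) _ (@mesh_isd n k)).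
move=> l [sl ml] /=.
have [w lw] := lst_exists sl; rewrite lw (@ev_lst _ _ (simplexC R n)).
apply: allinU => x y.
rewrite !singE /=; apply: dP => j.
(* Every point of the small simplex is within [q n ^+ k] of its first vertex, hence two points are
   within twice that; this is why [k] was chosen with [q n ^+ k < d / 2]. *)
have cx (z : simplex R n) : `|co (scomb w z) j - co (w ord0) j| <= q n ^+ k.
  rewrite co_scomb -[X in _ - X]mul1r -[X in X * co (w ord0) j](co_sum z).
  rewrite mulr_suml -sumrB.
  apply: le_trans (ler_norm_sum _ _ _) _.
  rewrite -[leRHS]mul1r -[X in X * _ ^+ k](co_sum z) mulr_suml.
  apply: ler_sum => i _.
  rewrite -mulrBr normrM ger0_norm ?co_ge0// ler_wpM2l ?co_ge0//.
  by apply: ml; rewrite lw; apply: map_f; rewrite mem_enum.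
have := cx x; have := cx y; rewrite !ler_norml => /andP[? ?] /andP[? ?].
by rewrite ltr_norml; apply/andP; split; lra.
Qed.

(** Further subdivision preserves small oscillation, so the numbers of subdivisions needed by the
    finitely many simplices of [c] can simply be added. *)
Lemma chain_small n (c : chain R X n) g e : continuous g -> 0 < e ->
  exists k, allin (osc g e (n := n)) (iter k (@subdiv R X n) c).
Proof.
move=> gc e0.
have [k kP] : exists k, forall s, s \in dom c ->
    allin (osc g e (n := n)) (iter k (@subdiv R X n) (gen s)).
  elim: (dom c) => [|s r [k kP]]; first by exists 0%N.
  have [k' k'P] := simplex_small s gc e0.
  exists (k + k')%N => t; rewrite inE => /orP[/eqP ->|/kP tP].
    by rewrite iterD; exact: osc_iter_subdiv.
  by rewrite addnC iterD; exact: osc_iter_subdiv.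
exists k; have : allin (fun s => s \in dom c) c by [].
have isubE j (d : chain R X n) : iter j (@subdiv R X n) d =
    flin (fun s => iter j (@subdiv R X n) (gen s)) d.
  elim: j d => [|j IH] d.
    by apply: (additive_eq (f := idfun) (g := flin _)) => s /=; rewrite flinE.
  rewrite iterS IH.
  apply: (additive_eq (f := @subdiv R X n \o flin _) (g := flin _)) => s /=.
  by rewrite !flinE.
by rewrite isubE; apply: allin_additive => s sc /=; rewrite flinE; exact: kP.
Qed.

End Small.

(** * Homotopies *)

Section Push.
Variable R : realType.

Definition push (X Y : topologicalType) (f : continuousType X Y) n :
    chain R X n -> chain R Y n :=
  flin (fun s : singular R X n =>
    gen (sing (cts_comp (@cts_fun _ _ s) (@cts_fun _ _ f))) : chain R Y n).

HB.instance Definition _ X Y f n := GRing.Additive.on (@push X Y f n).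

Lemma pushU (X Y : topologicalType) f n s : @push X Y f n (gen s) =
  gen (sing (cts_comp (@cts_fun _ _ s) (@cts_fun _ _ f))).
Proof. exact: flinE. Qed.

Lemma boundary_push (X Y : topologicalType) (f : continuousType X Y) n
    (c : chain R X n.+1) :
  boundary (push f c) = push f (boundary c).
Proof.
apply: (additive_eq (f := @boundary R Y n \o push f (n := n.+1))
  (g := push f (n := n) \o @boundary R X n)) => s /=.
rewrite pushU !boundaryU raddf_sum; apply: eq_bigr => i _.
rewrite additive_scale /= pushU; congr (_ *: gen _).
exact/continuousEP.
Qed.

Lemma push_comp (X Y Z : topologicalType) (f : continuousType X Y)
    (g : continuousType Y Z) (h : continuousType X Z) n (c : chain R X n) :
  (forall x, h x = g (f x)) -> push g (push f c) = push h c.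
Proof.
move=> hgf; apply: (additive_eq (f := push g (n := n) \o push f (n := n))
  (g := push h (n := n))) => s /=.
by rewrite !pushU; congr gen; apply/continuousEP => x; rewrite !singE hgf.
Qed.

Lemma push_id (X : topologicalType) (f : continuousType X X) n
    (c : chain R X n) (A : set X) :
  (forall x, A x -> f x = x) -> supp A c -> push f c = c.
Proof.
move=> fid; apply: (additive_eq_in (f := push f (n := n)) (g := idfun)) => s sA /=.
rewrite pushU; congr gen; apply/continuousEP => x.
by rewrite singE fid //; apply: sA; exists x.
Qed.

Lemma supp_push (X Y : topologicalType) (f : continuousType X Y) n (c : chain R X n)
    (A : set X) (B : set Y) :
  (forall x, A x -> B (f x)) -> supp A c -> supp B (push f c).
Proof.
move=> AB; apply: allin_additive => s sA /=; rewrite pushU; apply: allinU.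
by move=> _ [x _ <-]; apply: AB; apply: sA; exists x.
Qed.

Lemma supp_pushT (X Y : topologicalType) (f : continuousType X Y) n
    (c : chain R X n) (B : set Y) :
  (forall x, B (f x)) -> supp B (push f c).
Proof.
move=> fB; apply: (@supp_push _ _ _ _ _ setT) => // s _; exact: subsetT.
Qed.

End Push.

Section Prism.
Variables (R : realType) (X Y : topologicalType).
Variable H : continuousType (X * R)%type Y.

Lemma at_time_continuous (t : R) : continuous (fun x : X => H (x, t)).
Proof.
apply: (cts_comp (f := fun x => (x, t))); last exact: cts_fun.
by apply: cts_pair => x; [exact: cvg_id|exact: cvg_cst].
Qed.

Definition at_time (t : R) : continuousType X Y := mkcts (@at_time_continuous t).

Local Notation KP n := (prodC (simplexC R n) (lineC R)).

Lemma prsing_continuous n (s : singular R X n) :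
  continuous (fun v : KP n => H (s v.1, v.2)).
Proof.
apply: (cts_comp (f := fun v : KP n => (s v.1, v.2))); last exact: cts_fun.
apply: cts_pair => v; last exact: cvg_snd.
by apply: continuous_comp; [exact: cvg_fst|exact: cts_fun].
Qed.

Definition prsing n (s : singular R X n) : continuousType (KP n) Y :=
  mkcts (@prsing_continuous n s).

Definition slice n (t : R) : simplexC R n -> KP n := fun v => (v, t).

Lemma slice_affine n t : affine (@slice n t).
Proof.
move=> m w x; congr pair; rewrite /slice /=.
by rewrite -mulr_suml co_sum mul1r.
Qed.

Lemma slice_continuous n t : continuous (@slice n t).
Proof. by apply: cts_pair; [move=> x; exact: cvg_id|exact: cst_continuous]. Qed.

Definition prv n : fg (seq (KP n)) := pr (slice 0) (slice 1) (vl R n).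

Definition prism n : chain R X n -> chain R Y n.+1 :=
  flin (fun s : singular R X n => ev (prsing s) n.+1 (prv n)).

HB.instance Definition _ n := GRing.Additive.on (@prism n).

Lemma prismU n s : @prism n (gen s) = ev (prsing s) n.+1 (prv n).
Proof. exact: flinE. Qed.

Lemma ev_slice n (s : singular R X n) t :
  ev (prsing s) n (lmap (slice t) (vl R n)) = push (at_time t) (gen s : chain R X n).
Proof.
rewrite pushU -ev_vl; symmetry; apply: ev_lmap; last by [].
  exact: slice_continuous.
exact: slice_affine.
Qed.

Lemma boundary_prism n (c : chain R X n.+1) :
  boundary (prism c) = push (at_time 1) c - push (at_time 0) c - prism (boundary c).
Proof.
apply: (additive_eq (f := @boundary R Y n.+1 \o @prism n.+1)
  (g := (push (at_time 1) (n := n.+1) \- push (at_time 0) (n := n.+1)) \-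
        (@prism n \o @boundary R X n))) => s /=.
rewrite prismU boundary_ev dL_pr !raddfB /= !ev_slice; congr (_ - _).
rewrite dL_vl boundaryU !raddf_sum; apply: eq_bigr => i _.
rewrite !additive_scale /= prismU; congr (_ *: _); symmetry.
pose f (v : KP n) : KP n.+1 := (coface i v.1, v.2).
have -> : pr (slice 0) (slice 1) (lmap (coface i) (vl R n)) = lmap f (prv n).
  exact: pr_lmap.
apply: ev_lmap => //.
  apply: cts_pair => v; last exact: cvg_snd.
  by apply: continuous_comp; [exact: cvg_fst|exact: coface_continuous].
move=> m w x; rewrite /f /=; congr pair; exact: coface_affine.
Qed.

Lemma boundary_prism0 (c : chain R X 0) :
  boundary (prism c) = push (at_time 1) c - push (at_time 0) c.
Proof.
apply: (additive_eq (f := @boundary R Y 0 \o @prism 0)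
  (g := push (at_time 1) (n := 0%N) \- push (at_time 0) (n := 0%N))) => s /=.
rewrite prismU boundary_ev dL_pr !raddfB /= !ev_slice.
rewrite /vl dL_lst big_ord1 scale1r [lst _]size0nil ?size_lst// prU /=.
by rewrite raddf0 subr0.
Qed.

Lemma supp_prism n (A : set X) (B : set Y) (c : chain R X n) :
  (forall x t, A x -> B (H (x, t))) -> supp A c -> supp B (prism c).
Proof.
move=> AB; apply: allin_additive => s sA /=; rewrite prismU.
by apply: ev_range => v; apply: AB; apply: sA; exists v.1.
Qed.

End Prism.

(** * Cycles, boundaries and supports *)

Section Cycles.
Variables (R : realType) (X : topologicalType).
Local Notation C n := (chain R X n).

Lemma boundary_boundary n (c : C n.+2) : boundary (boundary c) = 0.
Proof.
apply: (additive_eq (f := @boundary R X n \o @boundary R X n.+1) (g := \0)) => s /=.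
by rewrite -ev_vl !boundary_ev dLdL raddf0.
Qed.

(* Unlike [cycles], every [0]-chain is a cycle here: the homology is unreduced. *)
Definition cyc n : C n -> Prop :=
  match n with 0 => fun=> True | m.+1 => fun c => boundary c = 0 end.

Definition bnd n (c : C n) := exists b : C n.+1, boundary b = c.

Lemma cyc0 n : cyc (0 : C n).
Proof. by case: n => //= n; rewrite raddf0. Qed.

Lemma cycB n (c d : C n) : cyc c -> cyc d -> cyc (c - d).
Proof. by case: n c d => //= n c d c0 d0; rewrite raddfB /= c0 d0 subrr. Qed.

Lemma cycN n (c : C n) : cyc c -> cyc (- c).
Proof. by move=> cc; rewrite -sub0r; apply: cycB => //; exact: cyc0. Qed.

Lemma cycD n (c d : C n) : cyc c -> cyc d -> cyc (c + d).
Proof. by move=> cc cd; rewrite -[d]opprK; apply/cycB/cycN. Qed.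

Lemma cyc_sum n (I : finType) (F : I -> C n) : (forall i, cyc (F i)) ->
  cyc (\sum_i F i).
Proof.
by move=> FP; elim/big_ind : _ => [|c d|i _]; [exact: cyc0|exact: cycD|].
Qed.

Lemma cyc_boundary n (c : C n.+1) : cyc (boundary c).
Proof. by case: n c => //= n c; exact: boundary_boundary. Qed.

Lemma cyc_bnd n (c : C n) : bnd c -> cyc c.
Proof. by move=> [b <-]; exact: cyc_boundary. Qed.

Lemma bnd0 n : bnd (0 : C n).
Proof. by exists 0; rewrite raddf0. Qed.

Lemma bndB n (c d : C n) : bnd c -> bnd d -> bnd (c - d).
Proof. by move=> [b <-] [e <-]; exists (b - e); rewrite raddfB. Qed.

Lemma bndN n (c : C n) : bnd c -> bnd (- c).
Proof. by move=> [b <-]; exists (- b); rewrite raddfN. Qed.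

Lemma bndD n (c d : C n) : bnd c -> bnd d -> bnd (c + d).
Proof. by move=> [b <-] [e <-]; exists (b + e); rewrite raddfD. Qed.

Lemma bnd_sum n (I : finType) (P : pred I) (F : I -> C n) :
  (forall i, P i -> bnd (F i)) -> bnd (\sum_(i | P i) F i).
Proof.
by move=> FP; elim/big_ind : _ => [|c d|i]; [exact: bnd0|exact: bndD|exact: FP].
Qed.

Lemma bnd_sym n (c d : C n) : bnd (c - d) -> bnd (d - c).
Proof. by rewrite -[d - c]opprB; exact: bndN. Qed.

Lemma bnd_trans n (c d e : C n) : bnd (c - d) -> bnd (d - e) -> bnd (c - e).
Proof. by move=> cd de; rewrite -[c](subrK d) -addrA; exact: bndD. Qed.

Lemma bnd_add n (c d c' d' : C n) : bnd (c - d) -> bnd (c' - d') ->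
  bnd (c + c' - (d + d')).
Proof. by move=> cd cd'; rewrite opprD addrACA; exact: bndD. Qed.

Lemma bnd_of n (c d : C n) : bnd (c - d) -> bnd d -> bnd c.
Proof. by move=> cd bd; rewrite -[c](subrK d); exact: bndD. Qed.

Lemma cyc_of n (c d : C n) : bnd (c - d) -> cyc c -> cyc d.
Proof. by move=> cd cc; rewrite -[d](subKr c); apply: cycB (cyc_bnd cd). Qed.

Lemma suppD n (A : set X) (c d : C n) : supp A c -> supp A d -> supp A (c + d).
Proof. exact: allinD. Qed.

Lemma suppB n (A : set X) (c d : C n) : supp A c -> supp A d -> supp A (c - d).
Proof. exact: allinB. Qed.

Lemma suppN n (A : set X) (c : C n) : supp A c -> supp A (- c).
Proof. exact: allinN. Qed.

Lemma suppT n (c : C n) : supp setT c.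
Proof. by move=> s _; exact: subsetT. Qed.

Lemma supp0 n (A : set X) : supp A (0 : C n).
Proof. exact: allin0. Qed.

Lemma suppS n (A B : set X) (c : C n) : A `<=` B -> supp A c -> supp B c.
Proof. by move=> AB; apply: allin_imp => s sA; exact: subset_trans AB. Qed.

Lemma suppI n (A B : set X) (c : C n) : supp A c -> supp B c -> supp (A `&` B) c.
Proof. by move=> cA cB s sc x sx; split; [exact: cA sx|exact: cB sx]. Qed.

Lemma supp_sum n (A : set X) (I : finType) (F : I -> C n) :
  (forall i, supp A (F i)) -> supp A (\sum_i F i).
Proof. exact: allin_sum. Qed.

Lemma cyc_subdiv n (c : C n) : cyc c -> cyc (subdiv c).
Proof. by case: n c => //= n c c0; rewrite boundary_subdiv c0 raddf0. Qed.

Lemma subdiv_homologous n (A : set X) (c : C n) : cyc c -> supp A c ->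
  exists2 b, supp A b & boundary b = c - subdiv c.
Proof.
move=> cc cA; exists (subdivh c); first exact: supp_subdivh.
case: n c cc {cA} => /= [|n] c c0; first exact: boundary_subdivh0.
by rewrite boundary_subdivh c0 raddf0 subr0.
Qed.

Lemma iter_subdivP n (A : set X) k (c : C n) : cyc c -> supp A c ->
  [/\ cyc (iter k (@subdiv R X n) c), supp A (iter k (@subdiv R X n) c) &
  exists2 b, supp A b & boundary b = c - iter k (@subdiv R X n) c].
Proof.
move=> cc cA; elim: k => [|k [cI AI [b bA bE]]] /=.
  by split => //; exists 0; rewrite ?raddf0 ?subrr //; exact: supp0.
split; [exact: cyc_subdiv|exact: supp_subdiv|].
have [d dA dE] := subdiv_homologous cI AI.
exists (b + d); first exact: suppD.
by rewrite raddfD /= bE dE addrA subrK.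
Qed.

Lemma iter_subdivD n k (c d : C n) : iter k (@subdiv R X n) (c + d) =
  iter k (@subdiv R X n) c + iter k (@subdiv R X n) d.
Proof. by elim: k => //= k ->; rewrite raddfD. Qed.

Lemma boundary_iter_subdiv n k (c : C n.+1) :
  boundary (iter k (@subdiv R X n.+1) c) = iter k (@subdiv R X n) (boundary c).
Proof. by elim: k => //= k <-; rewrite boundary_subdiv. Qed.

Lemma supp_iter_subdiv n A k (c : C n) : supp A c ->
  supp A (iter k (@subdiv R X n) c).
Proof. by move=> cA; elim: k => //= k; exact: supp_subdiv. Qed.

Lemma push_eq_in (Y : topologicalType) (f f' : continuousType X Y) n
    (A : set X) (c : C n) :
  (forall x, A x -> f x = f' x) -> supp A c -> push f c = push f' c.
Proof.
move=> ff'; apply: (additive_eq_in (f := push f (n := n)) (g := push f' (n := n))).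
move=> s sA /=; rewrite !pushU; congr gen; apply/continuousEP => x.
by rewrite !singE ff' //; apply: sA; exists x.
Qed.

End Cycles.

Arguments suppT {R X n} c.

Lemma cyc_push (R : realType) (X Y : topologicalType) (f : continuousType X Y) n
    (c : chain R X n) :
  cyc c -> cyc (push f c).
Proof. by case: n c => //= n c c0; rewrite boundary_push c0 raddf0. Qed.

Lemma bnd_push (R : realType) (X Y : topologicalType) (f : continuousType X Y) n
    (c : chain R X n) :
  bnd c -> bnd (push f c).
Proof. by move=> [b <-]; exists (push f b); rewrite boundary_push. Qed.

Lemma push_cancel (R : realType) (X Y : topologicalType) (f : continuousType X Y)
    (g : continuousType Y X) n (c : chain R X n) :
  cancel f g -> push g (push f c) = c.
Proof.
move=> fK.
pose h : continuousType X X := mkcts (cts_comp (@cts_fun _ _ f) (@cts_fun _ _ g)).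
rewrite (@push_comp _ _ _ _ f g h) //.
by apply: push_id (suppT c) => x _; exact: fK.
Qed.

Lemma homotopy (R : realType) (X Y : topologicalType)
    (H : continuousType (X * R)%type Y) n (A : set X) (B : set Y) (c : chain R X n) :
  (forall x t, A x -> B (H (x, t))) -> cyc c -> supp A c ->
  exists2 b, supp B b & boundary b = push (at_time H 1) c - push (at_time H 0) c.
Proof.
move=> AB cc cA; exists (prism H c); first exact: supp_prism AB cA.
case: n c cc {cA} => /= [|n] c c0; first exact: boundary_prism0.
by rewrite boundary_prism c0 raddf0 subr0.
Qed.

(** Unreduced homology presented by a map on chains, with no quotient. Additivity is asked on cycles
    only, because the map built for a bundle goes through a chosen splitting of each cycle. *)
Definition homology_is (R : realType) (X : topologicalType) n (G : zmodType) :=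
  exists f : chain R X n -> G,
    [/\ forall c d, cyc c -> cyc d -> f (c - d) = f c - f d,
        forall c, cyc c -> (f c = 0 <-> bnd c) &
        forall r, exists2 c, cyc c & f c = r].

(** * Mayer-Vietoris for a bundle over a suspension *)

Section SuspensionBundle.
Variables (R : realType) (X Y : topologicalType) (m : nat).
(** The model is the projection [p] of Y x S_(m+1) with height [g]: [s0] and [s1] are the sections
    over the poles and [sh i] the one over the middle of arc [i]. [HU], [HV] and [HW] contract the
    two cones and the middle arcs [W i] onto these sections, and [H01] joins [s0] to [s1]. *)
Variables (p : continuousType X Y) (g : X -> R).
Variables (s0 s1 : continuousType Y X) (sh : 'I_m.+1 -> continuousType Y X).
Variables HU HV HW : continuousType (X * R)%type X.
Variable H01 : continuousType (Y * R)%type X.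
Variable W : 'I_m.+1 -> set X.

Let U := [set x | g x < 2/3].
Let V := [set x | 1/3 < g x].

Hypothesis g_cts : continuous g.
Hypothesis ps0 : forall y, p (s0 y) = y.
Hypothesis psh : forall i y, p (sh i y) = y.
Hypothesis s0U : forall y, U (s0 y).
Hypothesis shW : forall i y, W i (sh i y).
Hypothesis HU0 : forall x, HU (x, 0) = x.
Hypothesis HV0 : forall x, HV (x, 0) = x.
Hypothesis HW0 : forall x, HW (x, 0) = x.
Hypothesis HU1 : forall x, U x -> HU (x, 1) = s0 (p x).
Hypothesis HV1 : forall x, V x -> HV (x, 1) = s1 (p x).
Hypothesis HW1 : forall i x, W i x -> HW (x, 1) = sh i (p x).
Hypothesis HUU : forall x t, U x -> U (HU (x, t)).
Hypothesis HVV : forall x t, V x -> V (HV (x, t)).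
Hypothesis HWW : forall i x t, W i x -> W i (HW (x, t)).
Hypothesis H010 : forall y, H01 (y, 0) = s0 y.
Hypothesis H011 : forall y, H01 (y, 1) = s1 y.
Hypothesis WUV : forall i, W i `<=` U `&` V.
Hypothesis Wdisj : forall i j x, W i x -> W j x -> i = j.
Hypothesis W_connected : forall n (s : singular R X n), range s `<=` U `&` V ->
  exists i, range s `<=` W i.

Local Notation C n := (chain R X n).

Lemma retract (H : continuousType (X * R)%type X) (s : continuousType Y X)
    (A : set X) n (c : C n) :
  (forall x, H (x, 0) = x) -> (forall x, A x -> H (x, 1) = s (p x)) ->
  (forall x t, A x -> A (H (x, t))) -> cyc c -> supp A c ->
  exists2 b, supp A b & boundary b = push s (push p c) - c.
Proof.
move=> H0 H1 HA cc cA; have [b bA bE] := homotopy HA cc cA.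
exists b => //; rewrite bE; congr (_ - _); last by apply: push_id cA => x _; exact: H0.
pose h : continuousType X X := mkcts (cts_comp (@cts_fun _ _ p) (@cts_fun _ _ s)).
rewrite (@push_comp _ _ _ _ p s h) //.
by apply: push_eq_in cA => x /H1.
Qed.

Lemma s1_homologous n (c : chain R Y n) : cyc c -> bnd (push s1 c - push s0 c).
Proof.
move=> cc.
have [b _ bE] := @homotopy R Y X H01 n setT setT c (fun _ _ _ => I) cc (suppT c).
exists b; rewrite bE; congr (_ - _); apply: push_eq_in (suppT c) => y _.
  exact: H011.
exact: H010.
Qed.

Definition splits n (c u v : C n) :=
  [/\ supp U u, supp V v & bnd (c - (u + v))].

(** A simplex that reaches height 1/3 or less stays below 2/3, as its oscillation is less than 1/3,
    and so lies in [U]; any other simplex lies in [V]. *)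
Lemma small_split n (c : C n) : allin (osc g (1/3) (n := n)) c ->
  exists u v, [/\ supp U u, supp V v & c = u + v].
Proof.
move=> cosc; pose P (s : singular R X n) := range s `<=` U.
exists (res P c), (c - res P c); split; last by rewrite addrC subrK.
  exact: res_allin.
apply: res_sub; apply: allin_imp cosc => s sosc.
have [[x sx]|nx] := pselect (exists x, g (s x) <= 1/3); [left|right].
  move=> _ [y _ <-]; rewrite /U /=.
  by have := sosc y x; rewrite ltr_norml => /andP[_ h]; lra.
move=> _ [y _ <-]; rewrite /V /= ltNge; apply/negP => sy; apply: nx.
by exists y.
Qed.

Lemma split_exists n (c : C n) : cyc c -> exists u v, splits c u v.
Proof.
move=> cc; have e0 : 0 < 1/3 :> R by lra.
have [k kP] := chain_small c g_cts e0.
have [u [v [uU vV cuv]]] := small_split kP.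
have [_ _ [b _ bE]] := iter_subdivP k cc (suppT c).
by exists u, v; split => //; exists b; rewrite -cuv.
Qed.

Definition resW n (i : 'I_m.+1) : C n -> C n :=
  res (fun s : singular R X n => range s `<=` W i).

HB.instance Definition _ n i := GRing.Additive.on (@resW n i).

Lemma singW n (s : singular R X n) i : range s `<=` W i ->
  forall j, resW j (gen s : C n) = if i == j then gen s else 0.
Proof.
move=> sW j; rewrite /resW resU; have [<-|ij] := eqVneq i j.
  by rewrite asboolT.
rewrite asboolF // => sWj; move/eqP: ij; apply.
pose x := s (vtx R ord0); have xs : range s x by exists (vtx R ord0).
exact: Wdisj (sW _ xs) (sWj _ xs).
Qed.

Lemma resW_id n i (c : C n) : supp (W i) c -> resW i c = c.
Proof. exact: res_id. Qed.

Lemma resW_neq n i j (c : C n) : supp (W i) c -> i != j -> resW j c = 0.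
Proof.
move=> cW /negbTE ij.
apply: (additive_eq_in (f := resW (n := n) j) (g := \0) _ cW) => s sW /=.
by rewrite (singW sW) ij.
Qed.

Lemma supp_resW n i (c : C n) : supp (W i) (resW i c).
Proof. exact: res_allin. Qed.

Lemma sum_resW n (c : C n) : supp (U `&` V) c -> \sum_i resW i c = c.
Proof.
move=> cUV; transitivity (flin (fun s => \sum_i resW i (gen s : C n)) c).
  have E (d : C n) : \sum_i resW i d = flin (fun s => \sum_i resW i (gen s : C n)) d.
    rewrite /resW; under eq_bigr do rewrite [res _ d]/res.
    elim: (index_enum _) => [|i r IH].
      rewrite big_nil; symmetry.
      by apply: (additive_eq (f := flin _) (g := \0)) => s /=; rewrite flinE big_nil.
    rewrite big_cons IH; symmetry.
    apply: (additive_eq (f := flin _) (g := resW (n := n) i \+ flin _)) => s /=.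
    by rewrite !flinE big_cons.
  exact: E.
apply: (additive_eq_in (f := flin _) (g := idfun) _ cUV) => s sUV /=.
have [i sW] := W_connected sUV.
rewrite flinE (bigD1 i) //= (singW sW) eqxx big1 ?addr0 // => j.
by rewrite (singW sW) eq_sym => /negbTE ->.
Qed.

(** Each simplex of [c] lies in exactly one [W j], and so does its image under [F]; both sides
    therefore keep it or discard it together. *)
Lemma resW_comm n n' (F : {additive C n -> C n'}) i (c : C n) :
  (forall j d, supp (W j) d -> supp (W j) (F d)) -> supp (U `&` V) c ->
  F (resW i c) = resW i (F c).
Proof.
move=> FW cUV.
apply: (additive_eq_in (f := F \o resW (n := n) i) (g := resW (n := n') i \o F) _ cUV).
move=> s sUV /=; have [j sW] := W_connected sUV.
have Fs : supp (W j) (F (gen s)) by apply: FW; exact: allinU.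
rewrite (singW sW); have [<-|ji] := eqVneq j i; first by rewrite resW_id.
by rewrite (resW_neq Fs ji) raddf0.
Qed.

Lemma boundary_resW n i (c : C n.+1) : supp (U `&` V) c ->
  boundary (resW i c) = resW i (boundary c).
Proof.
apply: (resW_comm (F := @boundary R X n)) => j d; exact: supp_boundary.
Qed.

Lemma resW_iter_subdiv n k i (c : C n) : supp (U `&` V) c ->
  resW i (iter k (@subdiv R X n) c) = iter k (@subdiv R X n) (resW i c).
Proof.
move=> cUV; elim: k => //= k <-; symmetry.
apply: (resW_comm (F := @subdiv R X n)) => [j d|]; first exact: supp_subdiv.
exact: supp_iter_subdiv.
Qed.

(* The component at the arc [i] of the Mayer-Vietoris connecting homomorphism,
   for the cover [U], [V]. *)
Definition conn n i (u : C n.+1) : chain R Y n := push p (resW i (boundary u)).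

Lemma conn_additive n i : zmod_morphism (@conn n i).
Proof. by move=> u v; rewrite /conn raddfB /= [resW _ _]raddfB [LHS]raddfB. Qed.

HB.instance Definition _ n i :=
  GRing.isZmodMorphism.Build (C n.+1) (chain R Y n) (@conn n i)
    (@conn_additive n i).

Definition cyclic_pair n (u v : C n.+1) :=
  [/\ supp U u, supp V v & boundary (u + v) = 0].

Lemma cyclic_pair_supp n (u v : C n.+1) : cyclic_pair u v ->
  supp (U `&` V) (boundary u).
Proof.
move=> [uU vV uv0]; apply: suppI; first exact: supp_boundary.
have -> : boundary u = - boundary v.
  by apply/eqP; rewrite -addr_eq0 -raddfD /= uv0.
by apply: suppN; exact: supp_boundary.
Qed.

Lemma splits_cyclic_pair n (c u v : C n.+1) : cyc c -> splits c u v ->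
  cyclic_pair u v.
Proof. by move=> cc [uU vV b]; split => //; exact: (cyc_of b cc). Qed.

Lemma cyc_resW n i (u v : C n.+1) : cyclic_pair u v -> cyc (resW i (boundary u)).
Proof.
move=> /cyclic_pair_supp uUV; case: n u uUV {v} => //= n u uUV.
by rewrite boundary_resW // boundary_boundary raddf0.
Qed.

Lemma cyc_conn n i (u v : C n.+1) : cyclic_pair u v -> cyc (conn i u).
Proof. by move=> uv; apply: cyc_push; exact: cyc_resW uv. Qed.

(** Let b bound u + v, and write a fine subdivision of b as ub + vb. Then w = Su - d(ub) = d(vb) -
    Sv has support in both [U] and [V], and dw = S(du). Its restriction to [W i] bounds the
    subdivided component, which is homologous to the component itself. *)
Lemma conn_bnd n i (u v : C n.+1) : cyclic_pair u v -> bnd (u + v) ->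
  bnd (conn i u).
Proof.
move=> uv [b bE]; have [uU vV uv0] := uv; have uUV := cyclic_pair_supp uv.
have e0 : 0 < 1/3 :> R by lra.
have [k kP] := chain_small b g_cts e0.
have [ub [vb [ubU vbV bk]]] := small_split kP.
pose S j := iter k (@subdiv R X j).
pose w := S n.+1 u - boundary ub.
have wE : w = boundary vb - S n.+1 v.
  apply/eqP; rewrite /w subr_eq addrAC eq_sym subr_eq eq_sym.
  by rewrite -raddfD /= [vb + ub]addrC -bk boundary_iter_subdiv bE -iter_subdivD.
have wUV : supp (U `&` V) w.
  apply: suppI; last rewrite wE; apply: suppB.
  - exact: supp_iter_subdiv.
  - exact: supp_boundary.
  - exact: supp_boundary.
  - exact: supp_iter_subdiv.
have dw : boundary w = S n (boundary u).
  by rewrite raddfB /= boundary_boundary subr0 boundary_iter_subdiv.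
have [_ _ [t _ tE]] := iter_subdivP k (cyc_resW i uv) (@supp_resW n i _).
exists (push p (t + resW i w)).
rewrite boundary_push raddfD /= tE boundary_resW // dw resW_iter_subdiv //.
by rewrite subrK.
Qed.

(** The components add up to p(du) = d(pu). This is the one relation between them. *)
Lemma conn_sum_bnd n (u v : C n.+1) : cyclic_pair u v ->
  bnd (\sum_i conn i u).
Proof.
move=> uv; exists (push p u); rewrite boundary_push.
rewrite -[in LHS](sum_resW (cyclic_pair_supp uv)).
by rewrite raddf_sum.
Qed.

(** When all components bound in Y, lifting by [sh i] and correcting by the contraction of [W i]
    makes each piece of du bound a chain [w i] inside [W i]. Moving the sum of the [w i] from u to v
    leaves a cycle in [U] and a cycle in [V]; each is homologous to the pole section of its
    projection, and the two pole sections are homotopic. *)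
Lemma conn_kernel n (u v : C n.+1) : cyclic_pair u v ->
  (forall i, bnd (conn i u)) -> bnd (u + v - push s0 (push p (u + v))).
Proof.
move=> uv cu; have [uU vV uv0] := uv; have uUV := cyclic_pair_supp uv.
have wP i : exists w, supp (W i) w /\ boundary w = resW i (boundary u).
  have [e eE] := cu i.
  have [b bW bE] := retract HW0 (HW1 (i := i)) (HWW (i := i)) (cyc_resW i uv)
    (@supp_resW n i _).
  exists (push (sh i) e - b); split.
    by apply: suppB => //; apply: supp_pushT => y; exact: shW.
  by rewrite raddfB /= boundary_push eE bE subKr.
have [w wE] := choice wP.
pose ws := \sum_i w i.
have wUV : supp (U `&` V) ws.
  by apply: supp_sum => i; have [+ _] := wE i; apply: suppS; exact: WUV.
have dw : boundary ws = boundary u.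
  rewrite raddf_sum -[RHS](sum_resW uUV); apply: eq_bigr => i _ /=.
  by have [_ ->] := wE i.
have cu' : cyc (u - ws) by rewrite /= raddfB /= dw subrr.
have cv' : cyc (v + ws) by rewrite /= raddfD /= dw -raddfD addrC.
have uE : u + v = (u - ws) + (v + ws) by rewrite addrACA addNr addr0.
have [bu _ buE] := retract HU0 HU1 HUU cu' (suppB uU (suppS (@subIsetl _ _ _) wUV)).
have [bv _ bvE] := retract HV0 HV1 HVV cv' (suppD vV (suppS (@subIsetr _ _ _) wUV)).
rewrite uE [push p _]raddfD [push s0 _]raddfD; apply: bnd_add.
  by apply: bnd_sym; exists bu.
apply: bnd_trans (s1_homologous (cyc_push p cv')).
by apply: bnd_sym; exists bv.
Qed.

(** The chain w, the sum of the lifts of the [z i] by [sh i], projects to 0, so contracting each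
    cone exhibits -w as a boundary in [U] and in [V]. The difference of the two bounding chains is
    the required cycle; the sign of [- bu] makes its connecting boundary w. *)
Lemma conn_onto n (z : 'I_m.+1 -> chain R Y n) : (forall i, cyc (z i)) ->
  \sum_i z i = 0 ->
  exists u v : C n.+1, cyclic_pair u v /\ forall i, conn i u = z i.
Proof.
move=> cz sz; pose w : C n := \sum_i push (sh i) (z i).
have zW i : supp (W i) (push (sh i) (z i)) by apply: supp_pushT; exact: shW.
have wUV : supp (U `&` V) w.
  by apply: supp_sum => i; apply: suppS (zW i); exact: WUV.
have cw : cyc w by apply: cyc_sum => i; exact: cyc_push.
have pw : push p w = 0.
  rewrite raddf_sum -[RHS]sz; apply: eq_bigr => i _ /=.
  exact: push_cancel (@psh i).
have [bu buU buE] := retract HU0 HU1 HUU cw (suppS (@subIsetl _ _ _) wUV).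
have [bv bvV bvE] := retract HV0 HV1 HVV cw (suppS (@subIsetr _ _ _) wUV).
rewrite pw raddf0 sub0r in buE; rewrite pw raddf0 sub0r in bvE.
exists (- bu), bv; split.
  split; [exact: suppN| by [] |].
  by rewrite raddfD /= raddfN /= buE bvE opprK subrr.
move=> i; rewrite /conn raddfN /= buE opprK /w raddf_sum (bigD1 i) //=.
rewrite (resW_id (zW i)) big1 ?addr0; last first.
  by move=> j ji; apply: (resW_neq (zW j)).
exact: push_cancel (@psh i).
Qed.

(** In degree 0 both parts of a splitting are cycles already, so there is no connecting map: each
    part slides to a pole section, and [p] alone detects the class. *)
Lemma homology_bundle0 G : homology_is R Y 0 G -> homology_is R X 0 G.
Proof.
move=> [f [fB f0 fsurj]]; exists (fun c => f (push p c)); split.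
- by move=> c d _ _; rewrite raddfB fB.
- move=> c _; split=> [/f0 fc|bc]; last by apply/f0 => //; exact: bnd_push.
  have [u [v [uU vV cuv]]] := split_exists (I : cyc c).
  have [bu _ buE] := retract HU0 HU1 HUU (I : cyc u) uU.
  have [bv _ bvE] := retract HV0 HV1 HVV (I : cyc v) vV.
  apply: (bnd_of cuv).
  have uv : bnd (u + v - push s0 (push p (u + v))).
    rewrite [push p _]raddfD [push s0 _]raddfD; apply: bnd_add.
      by apply: bnd_sym; exists bu.
    apply: bnd_trans (s1_homologous (I : cyc (push p v))).
    by apply: bnd_sym; exists bv.
  apply: (bnd_of uv); apply: bnd_push; apply: bnd_of (fc I).
  by rewrite -raddfB; apply: bnd_push; exact: bnd_sym.
- by move=> r; have [c _ <-] := fsurj r; exists (push s0 c); rewrite ?push_cancel.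
Qed.

Lemma homology_bundleS n G G' : homology_is R Y n.+1 G -> homology_is R Y n G' ->
  homology_is R X n.+1 (G * 'rV[G']_m)%type.
Proof.
move=> [f [fB f0 fsurj]] [f' [f'B f'0 f'surj]].
have f'00 : f' 0 = 0 by apply/f'0; [exact: cyc0|exact: bnd0].
(* A splitting is chosen for each cycle, with the dummy 0 for other chains; by [fc_eq] the
   components depend only on the homology class. *)
have /choice[U_of U_ofP] : forall c : C n.+1, exists u, cyc c -> exists v, splits c u v.
  move=> c; have [/split_exists[u [v cuv]]|ncc] := pselect (cyc c).
    by exists u => _; exists v.
  by exists 0.
pose fc u : 'rV[G']_m := \row_j f' (conn (lift ord0 j) u).
have fcB u v u' v' : cyclic_pair u v -> cyclic_pair u' v' ->
    fc (u - u') = fc u - fc u'.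
  move=> uv uv'; apply/rowP => j; rewrite !mxE conn_additive f'B //.
    exact: cyc_conn uv.
  exact: cyc_conn uv'.
have fc_eq c d u v u' v' : cyc c -> cyc d -> splits c u v -> splits d u' v' ->
    bnd (c - d) -> fc u = fc u'.
  move=> cc cd cuv duv cbd; apply/eqP; rewrite -subr_eq0; apply/eqP.
  have uv := splits_cyclic_pair cc cuv; have uv' := splits_cyclic_pair cd duv.
  rewrite -(fcB _ _ _ _ uv uv'); have [uU vV uv0] := uv; have [uU' vV' uv0'] := uv'.
  have E : u - u' + (v - v') = (u + v) - (u' + v') by rewrite opprD addrACA.
  have cp : cyclic_pair (u - u') (v - v').
    by split; [exact: suppB|exact: suppB|rewrite E raddfB /= uv0 uv0' subrr].
  apply/rowP => j; rewrite !mxE; apply/f'0; first exact: cyc_conn cp.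
  apply: (conn_bnd _ cp); rewrite E.
  have [_ _ cuv'] := cuv; have [_ _ duv'] := duv.
  apply: bnd_trans (bnd_sym cuv') _; exact: bnd_trans cbd duv'.
have sB (c d u v u' v' : C n.+1) : splits c u v -> splits d u' v' ->
    splits (c - d) (u - u') (v - v').
  move=> [uU vV cuv] [uU' vV' duv]; split; [exact: suppB|exact: suppB|].
  rewrite addrACA -opprD; have -> : c - d - (u + v - (u' + v')) =
    (c - (u + v)) - (d - (u' + v')) by rewrite !opprD !opprK addrACA.
  exact: bndB.
exists (fun c => (f (push p c), fc (U_of c))); split.
- move=> c d cc cd; congr pair; first by rewrite raddfB fB //; exact: cyc_push.
  have [v cuv] := U_ofP c cc; have [v' duv] := U_ofP d cd.
  have [w cdw] := U_ofP _ (cycB cc cd).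
  rewrite /= -(fcB _ _ _ _ (splits_cyclic_pair cc cuv) (splits_cyclic_pair cd duv)).
  have e0 : bnd (c - d - (c - d)) by rewrite subrr; exact: bnd0.
  exact: (fc_eq _ _ _ _ _ _ (cycB cc cd) (cycB cc cd) cdw (sB _ _ _ _ _ _ cuv duv)).
- move=> c cc; have [v cuv] := U_ofP c cc; have uv := splits_cyclic_pair cc cuv.
  split=> [[fc0 fcu0]|bc].
    have [_ _ cuv'] := cuv.
    have cl j : bnd (conn (lift ord0 j) (U_of c)).
      by apply/f'0; [exact: cyc_conn uv|move/rowP: fcu0 => /(_ j); rewrite !mxE].
    have ci i : bnd (conn i (U_of c)).
      case: (unliftP ord0 i) => [j ->|->]; first exact: cl.
      (* The component at arc 0, left out of [fc], bounds because the sum and all the other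
         components do. *)
      have := conn_sum_bnd uv; rewrite big_ord_recl => cs.
      rewrite -[conn _ _](addrK (\sum_(j < m) conn (lift ord0 j) (U_of c))).
      by apply: bndB => //; apply: bnd_sum.
    apply: (bnd_of cuv'); apply: (bnd_of (conn_kernel uv ci)); apply: bnd_push.
    apply: (@bnd_of _ _ _ _ (push p c)); last by apply/f0 => //; exact: cyc_push.
    by rewrite -raddfB; apply: bnd_push; exact: bnd_sym.
  congr pair; first by apply/f0; [exact: cyc_push|exact: bnd_push].
  apply/rowP => j; rewrite !mxE; apply/f'0; first exact: cyc_conn uv.
  apply: conn_bnd uv _; have [_ _ cuv'] := cuv.
  by apply: bnd_of bc; exact: bnd_sym.
- move=> [r r'].
  have /choice[z zP] : forall j, exists z, cyc z /\ f' z = r' 0 j.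
    by move=> j; have [z cz fz] := f'surj (r' 0 j); exists z.
  pose zz i := if unlift ord0 i is Some j then z j else - \sum_j z j.
  have czz i : cyc (zz i).
    rewrite /zz; case: unliftP => [j _|_]; first by case: (zP j).
    by apply: cycN; apply: cyc_sum => j; case: (zP j).
  have szz : \sum_i zz i = 0.
    rewrite big_ord_recl {1}/zz unlift_none.
    have E j : zz (lift ord0 j) = z j by rewrite /zz liftK.
    by rewrite [X in _ + X](eq_bigr _ (fun j _ => E j)) addNr.
  have [u [v [uv uz]]] := conn_onto czz szz; have [uU vV uv0] := uv.
  (* The cycle u + v has the required components. Subtracting [push s0 y] corrects its projection
     and leaves the components alone, since [push s0 y] is a cycle inside [U]. *)
  have [y cy fy] := fsurj (f (push p (u + v)) - r).
  have s0y : splits (push s0 y) (push s0 y) 0.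
    split; [by apply: supp_pushT => x; exact: s0U|exact: supp0|].
    by rewrite addr0 subrr; exact: bnd0.
  have uvs : splits (u + v) u v by split => //; rewrite subrr; exact: bnd0.
  have cs0 : cyc (push s0 y) by exact: cyc_push.
  have cuv : cyc (u + v) by [].
  have cc := cycB cuv cs0.
  exists (u + v - push s0 y); first exact: cc.
  congr pair.
    rewrite raddfB /= (push_cancel _ ps0) fB //; last exact: cyc_push.
    by rewrite fy subKr.
  have [w cw] := U_ofP _ cc.
  have E : fc (U_of (u + v - push s0 y)) = fc (u - push s0 y).
    apply: (fc_eq _ _ _ _ _ _ cc cc cw (sB _ _ _ _ _ _ uvs s0y)).
    by rewrite subrr; exact: bnd0.
  rewrite E (fcB _ _ _ _ uv (splits_cyclic_pair cs0 s0y)).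
  have -> : fc (push s0 y) = 0.
    apply/rowP => j; rewrite !mxE /conn boundary_push [boundary y]cy.
    by rewrite !raddf0 f'00.
  rewrite subr0; apply/rowP => j; rewrite mxE uz /zz liftK.
  by case: (zP j).
Qed.

End SuspensionBundle.

(** * The suspension of a finite set *)

Section Theta.
Variable R : realType.

(** With this retraction onto [0, 1], arcs, segments and homotopies are parametrised by the whole
    line. *)
Definition clamp (x : R) : R := Num.max 0 (Num.min 1 x).

Lemma clampP x : 0 <= clamp x <= 1.
Proof. by rewrite /clamp le_max lexx ge_max ler01 ge_min lexx. Qed.

Lemma clamp_id x : 0 <= x <= 1 -> clamp x = x.
Proof. by move=> /andP[x0 x1]; rewrite /clamp min_r // max_r. Qed.

Lemma clamp_continuous : continuous clamp.
Proof.
apply: cts_max; first exact: cst_continuous.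
by apply: cts_min; [exact: cst_continuous|move=> x; exact: cvg_id].
Qed.

Definition hat (x : R) : R := Num.min x (1 - x).

Lemma hat_continuous : continuous hat.
Proof.
apply: cts_min; first by move=> x; exact: cvg_id.
by apply: ctsB; [exact: cst_continuous|move=> x; exact: cvg_id].
Qed.

Lemma hat_ge0 x : 0 <= x <= 1 -> 0 <= hat x.
Proof. by move=> /andP[? ?]; rewrite /hat le_min; apply/andP; split; lra. Qed.

Variable a : nat.

Definition arc_point (i : 'I_a) (x : R) : R * 'rV[R]_a :=
  (x, \row_k if k == i then hat x else 0).

(* The suspension of [a] points, as [a] arcs joining height 0 to height 1; the
   weights vanish exactly at the two poles. *)
Definition Theta : set (R * 'rV[R]_a) :=
  [set v | exists i x, 0 <= x <= 1 /\ v = arc_point i x].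

Definition hgt (z : Theta) : R := (set_val z).1.
Definition wt (z : Theta) (k : 'I_a) : R := (set_val z).2 0 k.

Lemma Theta_inj (z z' : Theta) : hgt z = hgt z' -> wt z =1 wt z' -> z = z'.
Proof.
move=> hz wz; apply: val_inj; move: hz wz; rewrite /hgt /wt !set_valE.
case: (\val z) (\val z') => [x v] [x' v'] /= -> vv; congr pair.
by apply/rowP => k; exact: vv.
Qed.

Lemma hgt_continuous : continuous hgt.
Proof.
apply: (cts_comp (f := set_val : Theta -> R * 'rV[R]_a) (g := fst)).
  exact: initial_continuous.
by move=> v; exact: cvg_fst.
Qed.

Lemma wt_continuous k : continuous (fun z => wt z k).
Proof.
apply: (cts_comp (f := fun z : Theta => (set_val z).2)
  (g := fun v : 'rV[R]_a => v 0 k)); last exact: coord_continuous.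
apply: (cts_comp (f := set_val : Theta -> R * 'rV[R]_a) (g := snd)).
  exact: initial_continuous.
by move=> v; exact: cvg_snd.
Qed.

Lemma continuous_Theta (T : topologicalType) (f : T -> Theta) :
  continuous (fun t => hgt (f t)) -> (forall k, continuous (fun t => wt (f t) k)) ->
  continuous f.
Proof.
move=> fh fw; apply: continuous_comp_initial.
rewrite (_ : set_val \o f = fun t => (hgt (f t), (set_val (f t)).2)).
  apply: cts_pair => //; apply: continuous_mx => i k.
  by rewrite ord1; exact: fw.
by apply/funext => t /=; rewrite /hgt; case: (set_val (f t)).
Qed.

Lemma arc_subproof i x : arc_point i (clamp x) \in Theta.
Proof. by rewrite inE; exists i, (clamp x); split => //; exact: clampP. Qed.

Definition Theta_arc i x : Theta := exist (fun v => v \in Theta) _ (arc_subproof i x).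

Lemma hgt_arc i x : hgt (Theta_arc i x) = clamp x.
Proof. by []. Qed.

Lemma wt_arc i x k : wt (Theta_arc i x) k = if k == i then hat (clamp x) else 0.
Proof. by rewrite /wt /= mxE. Qed.

Lemma arc_continuous i : continuous (Theta_arc i).
Proof.
apply: continuous_Theta; first exact: clamp_continuous.
move=> k; under [X in continuous X]eq_fun do rewrite wt_arc.
case: (k == i); last exact: cst_continuous.
exact: (cts_comp clamp_continuous hat_continuous).
Qed.

Lemma arc_exists (z : Theta) : exists i x, 0 <= x <= 1 /\ z = Theta_arc i x.
Proof.
have [i [x [x01 zx]]] := set_mem (valP z); exists i, x; split => //.
by apply: val_inj; rewrite /= clamp_id.
Qed.

Lemma arc_pole x i j : x = 0 \/ x = 1 -> Theta_arc i x = Theta_arc j x.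
Proof.
move=> x01; apply: Theta_inj => // k; rewrite !wt_arc.
have -> : hat (clamp x) = 0.
  by case: x01 => ->; rewrite clamp_id ?lexx ?ler01 // /hat ?subr0 ?subrr;
    [apply/min_idPl|apply/min_idPr].
by rewrite !if_same.
Qed.

Section Reparametrize.
Variable phi : R * R -> R.
Hypothesis phi_cts : continuous phi.
Hypothesis phi01 : forall x s, 0 <= x <= 1 -> 0 <= phi (x, s) <= 1.
Hypothesis phi_hat : forall x s, 0 <= x <= 1 -> hat (phi (x, s)) <= 3 * hat x.

(* The minimum transports the weight of the arc without mentioning its index,
   so that continuity at the two poles is automatic. *)
Definition repar_point (p : Theta * R) : R * 'rV[R]_a :=
  let y := phi (hgt p.1, p.2) in (y, \row_k Num.min (hat y) (3 * wt p.1 k)).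

(** On arc [i] the bound [phi_hat] makes the minimum equal to the new hat; at any other index the
    weight 0 wins, because the new hat is nonnegative. *)
Lemma repar_point_arc i x s : 0 <= x <= 1 ->
  repar_point (Theta_arc i x, s) = arc_point i (phi (x, s)).
Proof.
move=> x01; rewrite /repar_point /= hgt_arc clamp_id //; congr pair.
apply/rowP => k; rewrite !mxE wt_arc clamp_id //; case: ifP => _.
  by apply/min_idPl; exact: phi_hat.
by rewrite mulr0; apply/min_idPr; apply: hat_ge0; exact: phi01.
Qed.

Lemma repar_subproof p : repar_point p \in Theta.
Proof.
case: p => z s; have [i [x [x01 ->]]] := arc_exists z.
rewrite repar_point_arc // inE; exists i, (phi (x, s)); split => //.
exact: phi01.
Qed.

Definition repar (p : Theta * R) : Theta :=
  exist (fun v => v \in Theta) _ (repar_subproof p).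

Lemma repar_arc i x s : 0 <= x <= 1 -> repar (Theta_arc i x, s) = Theta_arc i (phi (x, s)).
Proof.
move=> x01; apply: val_inj; rewrite /= repar_point_arc // clamp_id //.
exact: phi01.
Qed.

Lemma repar_continuous : continuous repar.
Proof.
have hc : continuous (fun p : Theta * R => phi (hgt p.1, p.2)).
  apply: (cts_comp (f := fun p : Theta * R => (hgt p.1, p.2))); last exact: phi_cts.
  apply: cts_pair; last by move=> p; exact: cvg_snd.
  by apply: (cts_comp _ hgt_continuous) => p; exact: cvg_fst.
apply: continuous_Theta; first exact: hc.
move=> k; rewrite (_ : (fun t => _) = fun p : Theta * R =>
  Num.min (hat (phi (hgt p.1, p.2))) (3 * wt p.1 k)); last first.
  by apply/funext => p; rewrite /wt /= mxE.
apply: cts_min; first exact: (cts_comp hc hat_continuous).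
apply: ctsM; first exact: cst_continuous.
by apply: (cts_comp (f := fst) _ (@wt_continuous k)) => p; exact: cvg_fst.
Qed.

End Reparametrize.
End Theta.

(** * Deformations of the height *)

Section Moves.
Variable R : realType.
Implicit Types x y s t : R.

Definition slide (f : R -> R) (p : R * R) : R :=
  (1 - clamp p.2) * p.1 + clamp p.2 * f p.1.

Lemma convex_le t b c d : 0 <= t <= 1 -> b <= d -> c <= d ->
  (1 - t) * b + t * c <= d.
Proof.
move=> /andP[t0 t1] bd cd; have : 0 <= (1 - t) * (d - b) by rewrite mulr_ge0; lra.
have : 0 <= t * (d - c) by rewrite mulr_ge0; lra.
lra.
Qed.

Lemma convex_lt t b c d : 0 <= t <= 1 -> b < d -> c < d ->
  (1 - t) * b + t * c < d.
Proof.
move=> t01 bd cd; apply: le_lt_trans (_ : Num.max b c < d); last by rewrite gt_max bd.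
by apply: convex_le => //; rewrite le_max lexx ?orbT.
Qed.

Lemma convex_ge t b c d : 0 <= t <= 1 -> d <= b -> d <= c ->
  d <= (1 - t) * b + t * c.
Proof.
move=> t01 bd cd; rewrite -lerN2 opprD -!mulrN.
by apply: convex_le => //; rewrite lerN2.
Qed.

Lemma convex_gt t b c d : 0 <= t <= 1 -> d < b -> d < c ->
  d < (1 - t) * b + t * c.
Proof.
move=> t01 bd cd; rewrite -ltrN2 opprD -!mulrN.
by apply: convex_lt => //; rewrite ltrN2.
Qed.

Lemma slide0 f x : slide f (x, 0) = x.
Proof. by rewrite /slide /= clamp_id ?lexx ?ler01 //; ring. Qed.

Lemma slide1 f x : slide f (x, 1) = f x.
Proof. by rewrite /slide /= clamp_id ?lexx ?ler01 //; ring. Qed.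

Lemma slide_continuous f : continuous f -> continuous (slide f).
Proof.
have fstc : continuous (fun p : R * R => p.1) by move=> p; exact: cvg_fst.
have cc : continuous (fun p : R * R => clamp p.2).
  by apply: (cts_comp _ (@clamp_continuous R)) => p; exact: cvg_snd.
move=> fc; apply: ctsD.
  by apply: ctsM => //; apply: ctsB => //; exact: cst_continuous.
by apply: ctsM => //; exact: (cts_comp fstc fc).
Qed.

Section Bounds.
Variable f : R -> R.
Hypothesis f3 : forall x, 0 <= x <= 1 ->
  [/\ 0 <= f x, f x <= 1, f x <= 3 * x & 1 - f x <= 3 * (1 - x)].

Lemma slide01 x s : 0 <= x <= 1 -> 0 <= slide f (x, s) <= 1.
Proof.
move=> x01; have [f0 f1 _ _] := f3 x01; have /andP[x0 x1] := x01.
by rewrite convex_ge ?convex_le //=; exact: clampP.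
Qed.

(** The two bounds with factor 3 control [f] at the lower and at the upper pole, one for each branch
    of [hat]. The identity satisfies them too, so they pass to convex combinations. *)
Lemma slide_hat x s : 0 <= x <= 1 -> hat (slide f (x, s)) <= 3 * hat x.
Proof.
move=> x01; have [f0 f1 fx f1x] := f3 x01; have /andP[x0 x1] := x01.
have m1 : slide f (x, s) <= 3 * x by apply: convex_le => /=; [exact: clampP|lra|].
have m2 : 1 - 3 * (1 - x) <= slide f (x, s).
  by apply: convex_ge => /=; [exact: clampP|lra|lra].
rewrite /hat; case: (leP x (1 - x)) => _; rewrite ge_min.
  by rewrite m1.
by apply/orP; right; lra.
Qed.

End Bounds.

(* Profiles, of slope at most 3, that collapse [0, 2/3] to the lower pole, [1/3, 1]
   to the upper pole and [1/3, 2/3] to the equator. *)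
Definition pushdown x : R := Num.max 0 (3 * x - 2).
Definition pushup x : R := Num.min 1 (3 * x).
Definition center x : R := Num.max (Num.min (3 * x / 2) (1 / 2)) ((3 * x - 1) / 2).

Lemma lin_continuous (b c : R) : continuous (fun x => b * x + c).
Proof.
apply: ctsD; last exact: cst_continuous.
by apply: ctsM; [exact: cst_continuous|move=> x; exact: cvg_id].
Qed.

Lemma pushdown_continuous : continuous pushdown.
Proof. by apply: cts_max; [exact: cst_continuous|exact: lin_continuous]. Qed.

Lemma pushup_continuous : continuous pushup.
Proof.
apply: cts_min; first exact: cst_continuous.
by apply: ctsM; [exact: cst_continuous|move=> x; exact: cvg_id].
Qed.

Lemma center_continuous : continuous center.
Proof.
apply: cts_max.
  apply: cts_min; last exact: cst_continuous.
  by rewrite (_ : (fun x => _) = (fun x => 3 / 2 * x + 0));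
    [exact: lin_continuous|apply/funext => x; lra].
rewrite (_ : (fun x => _) = (fun x => 3 / 2 * x + - (1 / 2))).
  exact: lin_continuous.
by apply/funext => x; lra.
Qed.

Lemma pushdown_bounds x : 0 <= x <= 1 ->
  [/\ 0 <= pushdown x, pushdown x <= 1, pushdown x <= 3 * x &
      1 - pushdown x <= 3 * (1 - x)].
Proof. by rewrite /pushdown => /andP[? ?]; case: (leP 0 (3 * x - 2)) => ?; split; lra. Qed.

Lemma pushup_bounds x : 0 <= x <= 1 ->
  [/\ 0 <= pushup x, pushup x <= 1, pushup x <= 3 * x &
      1 - pushup x <= 3 * (1 - x)].
Proof. by rewrite /pushup => /andP[? ?]; case: (leP 1 (3 * x)) => ?; split; lra. Qed.

Lemma center_bounds x : 0 <= x <= 1 ->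
  [/\ 0 <= center x, center x <= 1, center x <= 3 * x &
      1 - center x <= 3 * (1 - x)].
Proof.
rewrite /center => /andP[? ?].
by case: (leP (3 * x / 2) (1 / 2)) => ?;
  case: (leP _ ((3 * x - 1) / 2)) => ?; split; lra.
Qed.

Lemma pushdown_lt x : x < 2 / 3 -> pushdown x = 0.
Proof. by rewrite /pushdown => ?; case: (leP 0 (3 * x - 2)) => ?; lra. Qed.

Lemma pushup_gt x : 1 / 3 < x -> pushup x = 1.
Proof. by rewrite /pushup => ?; case: (leP 1 (3 * x)) => ?; lra. Qed.

Lemma center_mid x : 1 / 3 < x -> x < 2 / 3 -> center x = 1 / 2.
Proof.
rewrite /center => ? ?.
by case: (leP (3 * x / 2) (1 / 2)) => ?;
  case: (leP _ ((3 * x - 1) / 2)) => ?; lra.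
Qed.

End Moves.

Section Segment.
Variables (R : realType) (n : nat) (u v : simplex R n).

Lemma segment_ge0 t i : 0 <= (1 - clamp t) * co u i + clamp t * co v i.
Proof. by apply: convex_ge; [exact: clampP|exact: co_ge0|exact: co_ge0]. Qed.

Lemma segment_sum t : \sum_i ((1 - clamp t) * co u i + clamp t * co v i) = 1.
Proof. by rewrite big_split -!mulr_sumr !co_sum /=; ring. Qed.

Definition segment (t : R) : simplex R n :=
  mksimplex (segment_ge0 t) (segment_sum t).

Lemma segment0 : segment 0 = u.
Proof.
by apply: co_inj => i; rewrite co_mksimplex clamp_id ?lexx ?ler01 //; ring.
Qed.

Lemma segment1 : segment 1 = v.
Proof.
by apply: co_inj => i; rewrite co_mksimplex clamp_id ?lexx ?ler01 //; ring.
Qed.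

Lemma segment_continuous : continuous segment.
Proof.
apply: continuous_simplex => i.
under [X in continuous X]eq_fun do rewrite co_mksimplex.
by apply: ctsD; apply: ctsM; try apply: ctsB; try exact: clamp_continuous;
  exact: cst_continuous.
Qed.

Lemma simplex_IVT (f : simplex R n -> R) (y : R) : continuous f ->
  f u <= y <= f v -> exists w, f w = y.
Proof.
move=> fc uyv; have fsc := cts_comp segment_continuous fc.
have [||c _ fcy] := @IVT R (fun t => f (segment t)) 0 1 y ler01.
- exact: continuous_subspaceT.
- rewrite segment0 segment1; have /andP[uy yv] := uyv.
  by rewrite ge_min uy le_max yv orbT.
- by exists (segment c).
Qed.

End Segment.

(** * The product of a space with a suspension *)

Section ProductTheta.
Variables (R : realType) (Y : topologicalType) (m : nat).
Local Notation T := (@Theta R m.+1).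
Local Notation X := (Y * T)%type.

Lemma fst_continuous : continuous (fst : X -> Y).
Proof. by move=> z; exact: cvg_fst. Qed.

Definition sect i (x : R) (y : Y) : X := (y, Theta_arc i x).

Lemma sect_continuous i x : continuous (sect i x).
Proof. by apply: cts_pair; [move=> y; exact: cvg_id|exact: cst_continuous]. Qed.

Definition slideX (f : R -> R) (fc : continuous f)
    (f3 : forall x, 0 <= x <= 1 ->
      [/\ 0 <= f x, f x <= 1, f x <= 3 * x & 1 - f x <= 3 * (1 - x)]) (q : X * R) : X :=
  (q.1.1, repar (a := m.+1) (@slide01 R f f3) (@slide_hat R f f3) (q.1.2, q.2)).

Lemma slideX_continuous f fc f3 : continuous (@slideX f fc f3).
Proof.
apply: cts_pair.
  apply: (cts_comp (f := fst) (g := fst)) => z; exact: cvg_fst.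
apply: (cts_comp (f := fun q : X * R => (q.1.2, q.2))); last first.
  by apply: repar_continuous; exact: slide_continuous.
apply: cts_pair; last by move=> z; exact: cvg_snd.
by apply: (cts_comp (f := fst) (g := snd)) => z; [exact: cvg_fst|exact: cvg_snd].
Qed.

Lemma slideX_arc f fc f3 y i x s : 0 <= x <= 1 ->
  @slideX f fc f3 ((y, Theta_arc i x), s) = (y, Theta_arc i (slide f (x, s))).
Proof. by move=> x01; rewrite /slideX /= repar_arc. Qed.

Definition mid_arc (i : 'I_m.+1) : set X :=
  [set z | [/\ 1 / 3 < hgt z.2, hgt z.2 < 2 / 3 & 0 < wt z.2 i]].

Lemma arc_ind (P : X -> Prop) : (forall y i x, 0 <= x <= 1 -> P (y, Theta_arc i x)) ->
  forall z, P z.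
Proof. by move=> H [y z]; have [i [x [x01 ->]]] := arc_exists z; exact: H. Qed.

Lemma W_arc y i j x : 0 <= x <= 1 ->
  mid_arc j (y, Theta_arc i x) <-> [/\ 1 / 3 < x, x < 2 / 3 & i = j].
Proof.
move=> x01; rewrite /mid_arc /= hgt_arc wt_arc clamp_id //; split=> -[x1 x2].
  by case: (eqVneq j i) => [-> //|_]; rewrite ltxx.
move=> ->; rewrite eqxx; split => //.
by rewrite /hat lt_min; apply/andP; split; lra.
Qed.

Lemma hgt2_continuous : continuous (fun z : X => hgt z.2).
Proof.
apply: (cts_comp (f := snd) (g := @hgt R m.+1)); last exact: hgt_continuous.
by move=> z; exact: cvg_snd.
Qed.

(** At heights strictly between 1/3 and 2/3 a weight is either 0 or more than 1/3. By the
    intermediate value theorem along a segment, a weight positive at one point of the simplex and 0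
    at another would take the value 1/6, which lies in the gap; so the arc cannot change. *)
Lemma W_connected n (s : singular R X n) :
  range s `<=` [set z | hgt z.2 < 2/3] `&` [set z | 1/3 < hgt z.2] ->
  exists i, range s `<=` mid_arc i.
Proof.
move=> sUV; pose x0 := vtx R (@ord0 n).
have sP u i : wt (s u).2 i = 0 \/ 1/3 < wt (s u).2 i.
  have := sUV _ (imageT s u); move: (s u); apply: arc_ind => y j x x01 [].
  rewrite /= hgt_arc wt_arc clamp_id // => x2 x1; case: ifP => _; last by left.
  by right; rewrite /hat lt_min; apply/andP; split; lra.
have [i i0] : exists i, 1/3 < wt (s x0).2 i.
  have := sUV _ (imageT s x0); move: (s x0); apply: arc_ind => y j x x01 [].
  rewrite /= hgt_arc clamp_id // => x2 x1; exists j; rewrite wt_arc eqxx clamp_id //.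
  by rewrite /hat lt_min; apply/andP; split; lra.
exists i => _ [u _ <-]; have [x2 x1] := sUV _ (imageT s u); split => //.
have [wu|?] := sP u i; last lra.
have fc : continuous (fun v => wt (s v).2 i).
  apply: (cts_comp (@cts_fun _ _ s) (g := fun z : X => wt z.2 i)).
  by apply: (cts_comp (f := snd) _ (@wt_continuous _ _ i)) => z; exact: cvg_snd.
have [|w wE] := @simplex_IVT R n u x0 _ (1/6) fc; first by rewrite wu; lra.
by have [|] := sP w i; rewrite wE; lra.
Qed.

Let HU := mkcts (@slideX_continuous _ (@pushdown_continuous R) (@pushdown_bounds R)).
Let HV := mkcts (@slideX_continuous _ (@pushup_continuous R) (@pushup_bounds R)).
Let HW := mkcts (@slideX_continuous _ (@center_continuous R) (@center_bounds R)).

Lemma H01_continuous : continuous (fun q : Y * R => (q.1, Theta_arc (@ord0 m) q.2) : X).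
Proof.
apply: cts_pair; first by move=> z; exact: cvg_fst.
by apply: (cts_comp (f := snd) _ (@arc_continuous _ _ ord0)) => z; exact: cvg_snd.
Qed.

Lemma slideX0 f fc f3 z : @slideX f fc f3 (z, 0) = z.
Proof. by move: z; apply: arc_ind => y i x x01; rewrite slideX_arc // slide0. Qed.

Lemma pushdown1 z : hgt z.2 < 2/3 -> HU (z, 1) = sect ord0 0 z.1.
Proof.
move: z; apply: arc_ind => y i x x01; rewrite /= hgt_arc clamp_id // => x2.
by rewrite /HU /mkcts slideX_arc // slide1 pushdown_lt // (arc_pole i ord0) //; left.
Qed.

Lemma pushup1 z : 1/3 < hgt z.2 -> HV (z, 1) = sect ord0 1 z.1.
Proof.
move: z; apply: arc_ind => y i x x01; rewrite /= hgt_arc clamp_id // => x1.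
by rewrite /HV /mkcts slideX_arc // slide1 pushup_gt // (arc_pole i ord0) //; right.
Qed.

Lemma center1 i z : mid_arc i z -> HW (z, 1) = sect i (1/2) z.1.
Proof.
move: z; apply: arc_ind => y j x x01 /W_arc[//|x1 x2 <-].
by rewrite /HW /mkcts slideX_arc // slide1 center_mid.
Qed.

Lemma pushdown_stable z t : hgt z.2 < 2/3 -> hgt (HU (z, t)).2 < 2/3.
Proof.
move: z; apply: arc_ind => y i x x01; rewrite /= hgt_arc clamp_id // => x2.
rewrite repar_arc // hgt_arc clamp_id.
  apply: convex_lt => //; first exact: clampP.
  by rewrite pushdown_lt //; lra.
by apply: slide01 => //; exact: pushdown_bounds.
Qed.

Lemma pushup_stable z t : 1/3 < hgt z.2 -> 1/3 < hgt (HV (z, t)).2.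
Proof.
move: z; apply: arc_ind => y i x x01; rewrite /= hgt_arc clamp_id // => x1.
rewrite repar_arc // hgt_arc clamp_id.
  apply: convex_gt => //; first exact: clampP.
  by rewrite pushup_gt //; lra.
by apply: slide01 => //; exact: pushup_bounds.
Qed.

Lemma center_stable i z t : mid_arc i z -> mid_arc i (HW (z, t)).
Proof.
move: z; apply: arc_ind => y j x x01 /W_arc[//|x1 x2 <-].
rewrite /HW /mkcts slideX_arc //.
apply/W_arc; first by apply: slide01 => //; exact: center_bounds.
split => //; [apply: convex_gt|apply: convex_lt] => //=; try exact: clampP.
  by rewrite center_mid //; lra.
by rewrite center_mid //; lra.
Qed.

Let H01 : continuousType (Y * R)%type X := mkcts H01_continuous.
Let s0 : continuousType Y X := mkcts (@sect_continuous ord0 0).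
Let s1 : continuousType Y X := mkcts (@sect_continuous ord0 1).
Let sh i : continuousType Y X := mkcts (@sect_continuous i (1/2)).

Lemma homology_prod_Theta0 G : homology_is R Y 0 G -> homology_is R X 0 G.
Proof.
apply: (@homology_bundle0 R X Y (mkcts fst_continuous) (fun z => hgt z.2)
  s0 s1 HU HV H01) => //.
- exact: hgt2_continuous.
- exact: slideX0.
- exact: slideX0.
- exact: pushdown1.
- exact: pushup1.
- exact: pushdown_stable.
- exact: pushup_stable.
Qed.

Lemma homology_prod_ThetaS n G G' :
  homology_is R Y n.+1 G -> homology_is R Y n G' ->
  homology_is R X n.+1 (G * 'rV[G']_m)%type.
Proof.
apply: (@homology_bundleS R X Y m (mkcts fst_continuous) (fun z => hgt z.2)
  s0 s1 sh HU HV HW H01 mid_arc) => //.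
- exact: hgt2_continuous.
- by move=> y; rewrite /= hgt_arc clamp_id ?lexx ?ler01 //; lra.
- by move=> i y; apply/W_arc; first lra; split => //; lra.
- exact: slideX0.
- exact: slideX0.
- exact: slideX0.
- exact: pushdown1.
- exact: pushup1.
- exact: center1.
- exact: pushdown_stable.
- exact: pushup_stable.
- exact: center_stable.
- by move=> i z [].
- move=> i j; apply: arc_ind => y k x x01 /W_arc[//|_ _ <-] /W_arc[//|_ _ <-] //.
- exact: W_connected.
Qed.

End ProductTheta.

(** * The tile complex as a product of two suspensions *)

Lemma homology_is_homeo (R : realType) (X Y : topologicalType) (f : X -> Y)
    (g : Y -> X) n G : continuous f -> continuous g -> cancel f g -> cancel g f ->
  homology_is R X n G -> homology_is R Y n G.
Proof.
move=> fc gc fK gK [h [hB h0 hsurj]].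
pose F : continuousType X Y := mkcts fc; pose H : continuousType Y X := mkcts gc.
exists (fun c => h (push H c)); split.
- by move=> c d cc cd; rewrite raddfB hB //; exact: cyc_push.
- move=> c cc; rewrite h0; last exact: cyc_push.
  by split=> [/(bnd_push F)|]; [rewrite push_cancel|exact: bnd_push].
- move=> r; have [c cc <-] := hsurj r; exists (push F c); first exact: cyc_push.
  by rewrite push_cancel.
Qed.

Lemma compact_homeo (T Z : topologicalType) (f : T -> Z) (g : Z -> T) :
  compact [set: T] -> hausdorff_space Z -> continuous f ->
  cancel f g -> cancel g f -> continuous g.
Proof.
move=> cT hZ fc fK gK; apply/continuous_closedP => A cA.
have -> : g @^-1` A = f @` A.
  apply/seteqP; split => [z Az|_ [t At <-]]; last by rewrite /= fK.
  by exists (g z); rewrite ?gK.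
apply: compact_closed => //; apply: continuous_compact.
  exact: continuous_subspaceT.
exact: subclosed_compact cA cT _.
Qed.

Lemma hausdorff_inj (T Z : topologicalType) (f : T -> Z) :
  continuous f -> injective f -> hausdorff_space Z -> hausdorff_space T.
Proof.
move=> fc fI hZ x y xy; apply/fI/hZ => A B fxA fyB.
have [t [tA tB]] := xy _ _ (fc _ _ fxA) (fc _ _ fyB).
by exists (f t).
Qed.

Lemma simplex0_eq (R : realType) (u v : simplex R 0) : u = v.
Proof.
apply: co_inj => k; rewrite ord1.
by have := co_sum u; have := co_sum v; rewrite !big_ord1 => -> ->.
Qed.

Section TileHomeo.
Variables (R : realType) (a b : nat).
(** The one-point factor lets the product formula start from the homology of a point; S_beta is the
    inner suspension, S_alpha the outer one. *)
Local Notation Target := ((simplex R 0 * @Theta R b) * @Theta R a)%type.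

Lemma Target_hausdorff : hausdorff_space Target.
Proof.
pose f (z : Target) : ('rV[R]_1 * (R * 'rV[R]_b)) * (R * 'rV[R]_a) :=
  ((set_val z.1.1, set_val z.1.2), set_val z.2).
apply: (hausdorff_inj (f := f)); last exact: norm_hausdorff.
- have c1 : continuous (fun z : Target => z.1) by move=> z; exact: cvg_fst.
  have c2 : continuous (fun z : Target => z.2) by move=> z; exact: cvg_snd.
  have c11 : continuous (fun z : Target => z.1.1).
    by apply: (cts_comp c1 (g := fst)) => z; exact: cvg_fst.
  have c12 : continuous (fun z : Target => z.1.2).
    by apply: (cts_comp c1 (g := snd)) => z; exact: cvg_snd.
  apply: cts_pair; first apply: cts_pair.
  + by apply: (cts_comp c11); exact: initial_continuous.
  + by apply: (cts_comp c12); exact: initial_continuous.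
  + by apply: (cts_comp c2); exact: initial_continuous.
- by move=> [[u v] w] [[u' v'] w'] [/val_inj -> /val_inj -> /val_inj ->].
Qed.

Lemma square_compact : compact (square R).
Proof.
rewrite (_ : square R = `[0, 1]%classic `*` `[0, 1]%classic).
  by apply: compact_setX; exact: segment_compact.
by apply/seteqP; split => -[x y] /=; rewrite /square /= !in_itv /=.
Qed.

Lemma tiles_compact : compact [set: tiles R a b].
Proof.
apply: sigT_compact => [|e]; first exact: finite_finset.
exact/compact_set_type/square_compact.
Qed.

Definition tile_point (e : kappa_edge a b) (q : square R) : Target :=
  ((vtx R ord0, Theta_arc e.2 (set_val q).2), Theta_arc e.1 (set_val q).1).

Lemma tile_point_continuous e : continuous (tile_point e).
Proof.
have c : continuous (set_val : square R -> R * R) by exact: initial_continuous.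
have c1 : continuous (fun q : square R => (set_val q).1).
  by apply: (cts_comp c (g := fst)) => z; exact: cvg_fst.
have c2 : continuous (fun q : square R => (set_val q).2).
  by apply: (cts_comp c (g := snd)) => z; exact: cvg_snd.
apply: cts_pair; last exact: (cts_comp c1 (@arc_continuous R a _)).
apply: cts_pair; first exact: cst_continuous.
exact: (cts_comp c2 (@arc_continuous R b _)).
Qed.

Definition tiles_map (p : tiles R a b) : Target :=
  tile_point (projT1 p) (projT2 p).

(** Equal labels force the same side and the same index carried by that side. The other index may
    differ, but along that side its coordinate is 0 or 1, where all arcs meet. *)
Lemma tiles_map_glued p q : glued p q -> tiles_map p = tiles_map q.
Proof.
case: p q => [[i j] u] [[i' j'] v] [s [s' [t [t01 ll pu qv]]]].
move: ll pu qv; rewrite /tiles_map /tile_point /=.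
case: s s' => -[] //= [<-] -> -> /=; congr pair; rewrite ?subr0 ?subrr //;
  try congr pair; apply: arc_pole; auto.
Qed.

(** The height gives [x = x']. If the arcs differ, the weight at [k] is [hat x] on one side and 0 on
    the other, which puts the point at a pole. *)
Lemma Theta_arc_eq (c : nat) (k k' : 'I_c) (x x' : R) : 0 <= x <= 1 -> 0 <= x' <= 1 ->
  Theta_arc k x = Theta_arc k' x' -> x = x' /\ (k = k' \/ x = 0 \/ x = 1).
Proof.
move=> x01 x01' kk; have xx : x = x'.
  by have := congr1 (@hgt R c) kk; rewrite !hgt_arc !clamp_id.
split => //; have := congr1 (fun z => wt z k) kk.
rewrite !wt_arc eqxx clamp_id //; case: eqVneq => [->|_]; first by left.
move=> h0; right; move: h0; rewrite /hat.
by case: leP => _ ?; [left|right; lra].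
Qed.

Lemma square01 (q : square R) : 0 <= (set_val q).1 <= 1 /\ 0 <= (set_val q).2 <= 1.
Proof. exact: set_mem (valP q). Qed.

(** One index is changed at a time, through the tile (i', j); at a corner this takes two gluings. *)
Lemma glued_tiles i i' j j' (u : square R) :
  (i = i' \/ (set_val u).1 = 0 \/ (set_val u).1 = 1) ->
  (j = j' \/ (set_val u).2 = 0 \/ (set_val u).2 = 1) ->
  clos_refl_sym_trans (tiles R a b) (@glued R a b)
    (existT _ (i, j) u) (existT _ (i', j') u).
Proof.
have [u1 u2] := square01 u; move=> ii jj.
apply: (rst_trans _ _ _ (existT _ (i', j) u)).
  case: ii => [->|ii]; first exact: rst_refl.
  apply: rst_step; case: ii => ux.
    (* The left and top sides are traversed backwards by the anticlockwise boundary, hence the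
       parameter 1 minus the coordinate. *)
    exists Left, Left, (1 - (set_val u).2); split => //=; first by lra.
      by rewrite subKr [LHS]surjective_pairing ux.
    by rewrite subKr [LHS]surjective_pairing ux.
  exists Right, Right, (set_val u).2; split => //=.
    by rewrite [LHS]surjective_pairing ux.
  by rewrite [LHS]surjective_pairing ux.
case: jj => [->|jj]; first exact: rst_refl.
apply: rst_step; case: jj => uy.
  exists Bottom, Bottom, (set_val u).1; split => //=.
    by rewrite [LHS]surjective_pairing uy.
  by rewrite [LHS]surjective_pairing uy.
exists Top, Top, (1 - (set_val u).1); split => //=; first by lra.
  by rewrite subKr [LHS]surjective_pairing uy.
by rewrite subKr [LHS]surjective_pairing uy.
Qed.

Lemma tiles_map_inj p q : tiles_map p = tiles_map q ->
  clos_refl_sym_trans (tiles R a b) (@glued R a b) p q.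
Proof.
case: p q => [[i j] u] [[i' j'] v].
rewrite /tiles_map /tile_point /= => E.
have ii := congr1 snd E; have jj := congr1 (fun z => z.1.2) E.
have [u1 u2] := square01 u; have [v1 v2] := square01 v.
have [x_eq ii'] := Theta_arc_eq u1 v1 ii; have [y_eq jj'] := Theta_arc_eq u2 v2 jj.
have uv : u = v.
  apply: val_inj; move: x_eq y_eq; rewrite !set_valE.
  by case: (\val u) (\val v) => ? ? [? ?] /= -> ->.
by rewrite -uv; exact: glued_tiles.
Qed.

Local Notation TCab := (TC R a b).

(** The map on tiles is constant on gluing classes, so the representative taken in [TC_map] does not
    matter. *)
Lemma tiles_map_repr p : tiles_map (repr (\pi_TCab p)%qT) = tiles_map p.
Proof.
have H q : clos_refl_sym_trans (tiles R a b) (@glued R a b) q p ->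
    tiles_map q = tiles_map p.
  by elim=> [x y|//|x y _ ->//|x y z _ -> _ ->//]; exact: tiles_map_glued.
apply: H; apply/asboolP.
by have /eqmodP : (repr (\pi_TCab p) = p %[mod TCab])%qT by rewrite reprK.
Qed.

Definition TC_map (z : TCab) : Target := tiles_map (repr z).

Lemma TC_map_continuous : continuous TC_map.
Proof.
apply/quotient_continuous.
rewrite (_ : _ \o _ = tiles_map); last by apply/funext => p; exact: tiles_map_repr.
exact: (@sigT_continuous (kappa_edge a b) (fun=> square R) Target _
  tile_point_continuous).
Qed.

Lemma TC_map_inj : injective TC_map.
Proof.
move=> z z' /tiles_map_inj zz.
rewrite -[z]reprK -[z']reprK; apply/eqmodP; exact/asboolP.
Qed.

Lemma TC_map_surj (w : Target) : exists z, TC_map z = w.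
Proof.
case: w => [[v w] z]; have [j [y [y01 ->]]] := arc_exists w.
have [i [x [x01 ->]]] := arc_exists z.
have sq : (x, y) \in square R by rewrite inE.
exists (\pi_TCab (existT _ (i, j) (exist (fun q => q \in square R) _ sq)))%qT.
rewrite /TC_map tiles_map_repr /tiles_map /tile_point /=; congr (_, _, _).
exact: simplex0_eq.
Qed.

Lemma TC_compact : compact [set: TCab].
Proof.
have -> : [set: TCab] = (\pi_TCab)%qT @` [set: tiles R a b].
  by apply/seteqP; split => // z _; exists (repr z); rewrite ?reprK.
apply: continuous_compact; last exact: tiles_compact.
apply: continuous_subspaceT; exact: pi_continuous.
Qed.

Lemma homology_TC n G : homology_is R Target n G -> homology_is R TCab n G.
Proof.
have [g gK] := choice TC_map_surj.
have fK : cancel TC_map g by move=> z; apply: TC_map_inj; rewrite gK.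
apply: (homology_is_homeo (f := g) (g := TC_map)) => //.
  exact: compact_homeo TC_compact Target_hausdorff TC_map_continuous fK gK.
exact: TC_map_continuous.
Qed.

End TileHomeo.

(** * Homology groups *)

Section ReducedHomology.
Variables (R : realType) (X : topologicalType).
Local Notation C n := (chain R X n).

Lemma isomorphic_reduced n (G : zmodType) (f : C n -> G) :
  (forall c d, c \in @cycles R X n -> d \in @cycles R X n -> f (c - d) = f c - f d) ->
  (forall c, c \in @cycles R X n -> (f c = 0 <-> bnd c)) ->
  (forall r, exists2 c, c \in @cycles R X n & f c = r) ->
  isomorphic (reduced_homology R X n) G.
Proof.
move=> fB f0 fsurj.
pose F (q : reduced_homology R X n) := f (cycle_chain (repr q)).
have cP (z : cycle_group R X n) : cycle_chain z \in @cycles R X n by exact: cycle_chainP.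
(* Well-definedness: the chosen representative differs from [z] by a boundary, on which [f]
   vanishes. *)
have Fpi (z : cycle_group R X n) : F (\pi_(reduced_homology R X n) z)%qT = f z.
  apply/eqP; rewrite -subr_eq0 -fB //; apply/eqP/f0.
    exact: (cycle_chainP (repr (\pi_(reduced_homology R X n) z)%qT - z)).
  have : (repr (\pi_(reduced_homology R X n) z)%qT - z) \in @boundaries R X n.
    by rewrite Quotient.idealrBE reprK.
  by move=> /asboolP.
have Fadd : zmod_morphism F.
  move=> x y; rewrite -[x]reprK -[y]reprK.
  have -> : (\pi_(reduced_homology R X n) (repr x) - \pi_(reduced_homology R X n) (repr y))%qT
    = (\pi_(reduced_homology R X n) (repr x - repr y))%qT.
    by rewrite !piE.
  by rewrite !Fpi /= fB.
pose FA : {additive reduced_homology R X n -> G} :=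
  HB.pack F (GRing.isZmodMorphism.Build _ _ F Fadd).
exists FA.
have FI : injective F.
  move=> x y Fxy; rewrite -[x]reprK -[y]reprK; apply/eqP.
  rewrite -Quotient.idealrBE; apply/asboolP.
  apply/(f0 (cycle_chain (repr x) - cycle_chain (repr y))).
    exact: (cycle_chainP (repr x - repr y)).
  by rewrite fB //; apply/eqP; rewrite subr_eq0; apply/eqP.
have /choice[g gK] : forall r, exists q, F q = r.
  move=> r; have [c cc <-] := fsurj r.
  by exists (\pi_(reduced_homology R X n) (Cycle cc))%qT; rewrite Fpi.
by exists g => [x|r] //=; apply: FI; rewrite gK.
Qed.

Lemma isomorphic_reducedS n G : homology_is R X n.+1 G ->
  isomorphic (reduced_homology R X n.+1) G.
Proof.
move=> [f [fB f0 fsurj]].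
have cE c : c \in @cycles R X n.+1 -> cyc c by move/eqP.
apply: (isomorphic_reduced (f := f)) => [c d|c|r].
- by move=> /cE cc /cE cd; exact: fB.
- by move=> /cE; exact: f0.
- by have [c cc fc] := fsurj r; exists c => //; apply/eqP.
Qed.

Lemma isomorphic_reduced_trivial n :
  (forall c, c \in @cycles R X n -> bnd c) ->
  isomorphic (reduced_homology R X n) 'rV[int]_0.
Proof.
move=> cb; apply: (isomorphic_reduced (f := fun=> 0)) => [c d _ _|c cc|r].
- by rewrite subr0.
- by split=> // _; exact: cb.
- exists 0; last by apply/rowP => -[].
  exact: rpred0.
Qed.

Definition degree n (c : C n) : int := deg c.

Lemma degree_additive n : zmod_morphism (@degree n).
Proof. exact: deg_is_additive. Qed.

HB.instance Definition _ n :=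
  GRing.isZmodMorphism.Build (C n) int (@degree n) (@degree_additive n).

Lemma degreeU n (s : singular R X n) : degree (gen s : C n) = 1.
Proof. by rewrite /degree /gen degU. Qed.

Lemma degreeZ n (k : int) (c : C n) : degree (k *: c) = k * degree c.
Proof. by rewrite -{1}[k]intz scaler_int raddfMz /= mulrzz mulrC. Qed.

(** There are n + 2 faces with alternating signs: they cancel in pairs for even n and leave 1 for
    odd n. *)
Lemma degree_boundary n (s : singular R X n.+1) :
  degree (boundary (gen s : C n.+1)) = odd n.
Proof.
rewrite boundaryU raddf_sum /=.
under eq_bigr do rewrite degreeZ degreeU mulr1.
elim: n {s} => [|n IH]; first by rewrite !big_ord_recl big_ord0.
by rewrite big_ord_recr /= IH -signr_odd /= negbK; case: (odd n).
Qed.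

Lemma degree_bnd (c : C 0) : bnd c -> degree c = 0.
Proof.
move=> [b <-].
apply: (additive_eq (f := @degree 0 \o @boundary R X 0) (g := \0)) => s /=.
exact: degree_boundary.
Qed.

(** The given isomorphism [f] of H_0 with Z need not be the degree, but if [f e = 1] then the degree
    is [degree e] times [f]. A single simplex has degree 1, so [degree e] is not 0, and a chain of
    degree 0 has [f] equal to 0, hence bounds. *)
Lemma isomorphic_reduced0 : homology_is R X 0 int ->
  isomorphic (reduced_homology R X 0) 'rV[int]_0.
Proof.
move=> [f [fB f0 fsurj]]; apply: isomorphic_reduced_trivial => c /eqP dc.
have fadd : zmod_morphism f by move=> u v; exact: fB.
pose F : {additive C 0 -> int} :=
  HB.pack f (GRing.isZmodMorphism.Build _ _ f fadd).
have [e _ fe] := fsurj 1.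
have fz d : bnd (d - e *~ f d).
  apply/f0 => //; change (F (d - e *~ f d) = 0).
  by rewrite raddfB raddfMz /= fe intz subrr.
have degz d : degree d = degree e * f d.
  have := degree_bnd (fz d); rewrite raddfB /= raddfMz /= mulrzz => /eqP.
  by rewrite subr_eq0 => /eqP.
(* A singular simplex exists because [e], on which [f] takes the value 1, is not the zero chain. *)
have [s se] : exists s, s \in dom e.
  case E : (dom e) => [|s r]; last by exists s; rewrite inE eqxx.
  have e0 : e = 0 by apply/eqP; rewrite -dom_eq0 E.
  have : F 0 = 1 by rewrite -e0.
  by rewrite raddf0.
have /eqP : degree (gen s) = degree e * f (gen s) by exact: degz.
rewrite degreeU => de1.
have fc : f c = 0.
  have := degz c; rewrite [degree c]dc => /esym/eqP; rewrite mulf_eq0.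
  by case/orP => /eqP // de; rewrite de mul0r in de1.
by rewrite -[c]subr0; have := fz c; rewrite fc mulr0z.
Qed.

End ReducedHomology.

Section Acyclic.
Variables (R : realType) (X : topologicalType) (n : nat).

Lemma homology_is_iso (G H : zmodType) (h : {additive G -> H}) :
  bijective h -> homology_is R X n G -> homology_is R X n H.
Proof.
move=> [h' hK h'K] [f [fB f0 fsurj]]; exists (fun c => h (f c)); split.
- by move=> c d cc cd; rewrite fB // raddfB.
- move=> c cc; rewrite -f0 //; split=> [hf|->]; last exact: raddf0.
  by rewrite -[f c]hK hf -(raddf0 h) hK.
- by move=> r; have [c cc fc] := fsurj (h' r); exists c; rewrite // fc h'K.
Qed.

Lemma homology_is_trivial : (forall c : chain R X n, cyc c -> bnd c) ->
  homology_is R X n 'rV[int]_0.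
Proof.
move=> cb; exists (fun=> 0); split=> [c d _ _|c cc|r]; first by rewrite subr0.
  by split=> // _; exact: cb.
by exists 0; [exact: cyc0|apply/rowP => -[]].
Qed.

Lemma homology_is_acyclic (G : zmodType) : (forall x : G, x = 0) ->
  homology_is R X n G -> forall c : chain R X n, cyc c -> bnd c.
Proof. by move=> G0 [f [_ f0 _]] c cc; apply/f0. Qed.

End Acyclic.

(** * Homology of a point *)

Section Point.
Variable R : realType.
Local Notation pt := (simplex R 0).
Local Notation C n := (chain R pt n).

Lemma sing_pt_eq n (s t : singular R pt n) : s = t.
Proof. by apply/continuousEP => x; exact: simplex0_eq. Qed.

Definition sing_pt n : singular R pt n :=
  sing (@cst_continuous (simplex R n) pt (vtx R ord0)).

Lemma chain_pt n (c : C n) : c = gen (sing_pt n) *~ degree c.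
Proof.
have E (d : C n) : d = flin (fun s : singular R pt n =>
    gen (sing_pt n) *~ degree (gen s : C n) : C n) d.
  apply: (additive_eq (f := idfun) (g := flin _)) => s /=.
  by rewrite flinE degreeU; congr gen; exact: sing_pt_eq.
have F (d : C n) : flin (fun s : singular R pt n =>
    gen (sing_pt n) *~ degree (gen s : C n) : C n) d = gen (sing_pt n) *~ degree d.
  have madd : zmod_morphism (fun d : C n => gen (sing_pt n) *~ degree d).
    by move=> u v; rewrite raddfB /= mulrzBr.
  pose M : {additive C n -> C n} := HB.pack (fun d : C n => gen (sing_pt n) *~ degree d)
    (GRing.isZmodMorphism.Build _ _ (fun d : C n => gen (sing_pt n) *~ degree d) madd).
  by apply: (additive_eq (f := flin _) (g := M)) => s /=; rewrite flinE.
by rewrite -F.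
Qed.

Lemma degree_pt_eq0 n (c : C n) : degree c = 0 -> c = 0.
Proof. by move=> c0; rewrite [c]chain_pt c0 mulr0z. Qed.

Lemma homology_pt0 : homology_is R pt 0 int.
Proof.
exists (@degree R pt 0); split=> [c d _ _|c _|r]; first exact: raddfB.
  by split=> [/degree_pt_eq0 ->|/degree_bnd]; first exact: bnd0.
exists (gen (sing_pt 0) *~ r) => //.
by rewrite raddfMz /= degreeU intz.
Qed.

(** Each chain group of the point is Z through the degree, and the differentials are alternately 0
    and the identity. For odd n the differential out of degree n + 1 is injective; for even n the
    one into degree n + 1 is onto. *)
Lemma acyclic_pt n (c : C n.+1) : cyc c -> bnd c.
Proof.
move=> c0; case: (boolP (odd n)) => on.
  suff -> : c = 0 by exact: bnd0.
  apply: degree_pt_eq0.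
  have := congr1 (@degree R pt n) c0.
  rewrite {1}[c]chain_pt raddfMz raddfMz /= degree_boundary on raddf0.
  by rewrite mulrzz mul1r.
exists (gen (sing_pt n.+2) *~ degree c).
rewrite [RHS]chain_pt raddfMz /= [boundary _]chain_pt degree_boundary /= on.
by [].
Qed.

End Point.

(** * Homology of the tile complex *)

Section Homology.
Variable R : realType.

Let Y b := (simplex R 0 * @Theta R b.+1)%type.

Lemma homology_Theta0 b : homology_is R (Y b) 0 int.
Proof. exact/homology_prod_Theta0/homology_pt0. Qed.

Lemma snd_bij (H : zmodType) : bijective (snd : 'rV[int]_0 * H -> H).
Proof.
by exists (fun h => (0, h)) => // -[u h] /=; congr pair; apply/rowP => -[].
Qed.

Lemma homology_pt_trivial n : homology_is R (simplex R 0) n.+1 'rV[int]_0.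
Proof. by apply: homology_is_trivial; exact: acyclic_pt. Qed.

Lemma homology_Theta1 b : homology_is R (Y b) 1 'rV[int]_b.
Proof.
apply: homology_is_iso (snd_bij _) _.
exact: homology_prod_ThetaS (homology_pt_trivial 0) (homology_pt0 R).
Qed.

Lemma rV0_eq0 (G : zmodType) m : (forall x : G, x = 0) ->
  forall x : 'rV[int]_0 * 'rV[G]_m, x = 0.
Proof.
by move=> G0 [u v]; congr pair; apply/rowP => i; [case: i|rewrite [LHS]G0 mxE].
Qed.

Lemma rV_int0 (x : 'rV[int]_0) : x = 0.
Proof. by apply/rowP => -[]. Qed.

Lemma homology_ThetaSS b n : homology_is R (Y b) n.+2 'rV[int]_0.
Proof.
apply: homology_is_trivial.
apply: homology_is_acyclic (rV0_eq0 rV_int0) _.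
exact: homology_prod_ThetaS (homology_pt_trivial _) (homology_pt_trivial _).
Qed.

Definition row_pair m n (x : 'rV[int]_m * 'rV[int]_n) : 'rV[int]_(m + n) :=
  row_mx x.1 x.2.

Lemma row_pair_additive m n : zmod_morphism (@row_pair m n).
Proof.
by move=> [u v] [u' v']; rewrite /row_pair opp_row_mx add_row_mx.
Qed.

HB.instance Definition _ m n := GRing.isZmodMorphism.Build _ _ (@row_pair m n)
  (@row_pair_additive m n).

Lemma row_pair_bij m n : bijective (@row_pair m n).
Proof.
exists (fun v => (lsubmx v, rsubmx v)) => [[u v]|v]; rewrite /row_pair /=.
  by rewrite row_mxKl row_mxKr.
exact: hsubmxK.
Qed.

Definition row_concat m n (v : 'rV['rV[int]_n]_m) : 'rV[int]_(m * n) :=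
  mxvec (\matrix_(i, j) (v 0 i) 0 j).

Lemma row_concat_additive m n : zmod_morphism (@row_concat m n).
Proof.
move=> u v; rewrite /row_concat -raddfB /=; congr mxvec.
by apply/matrixP => i j; rewrite !mxE.
Qed.

HB.instance Definition _ m n := GRing.isZmodMorphism.Build _ _ (@row_concat m n)
  (@row_concat_additive m n).

Lemma row_concat_bij m n : bijective (@row_concat m n).
Proof.
exists (fun w => \row_i row i (vec_mx w)) => [v|w].
  by apply/rowP => i; apply/rowP => j; rewrite /row_concat mxvecK !mxE.
rewrite /row_concat -[RHS]vec_mxK; congr mxvec.
by apply/matrixP => i j; rewrite !mxE.
Qed.

Variables a b : nat.
Local Notation TCab := (TC R a.+1 b.+1).

Lemma homology_TC0 : homology_is R TCab 0 int.
Proof. exact/homology_TC/homology_prod_Theta0/homology_Theta0. Qed.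

(** The summand Z^b is H_1 of the inner suspension, and Z^a is the a-th power of its H_0; hence the
    order [b + a]. *)
Lemma homology_TC1 : homology_is R TCab 1 'rV[int]_(b + a).
Proof.
apply: homology_is_iso (@row_pair_bij b a) _; apply: homology_TC.
exact: homology_prod_ThetaS (homology_Theta1 b) (homology_Theta0 b).
Qed.

(** The inner suspension has no homology in degree 2, so only the a-th power of its H_1 = Z^b
    remains; the row of rows is then flattened. *)
Lemma homology_TC2 : homology_is R TCab 2 'rV[int]_(a * b).
Proof.
apply: homology_is_iso (@row_concat_bij a b) _.
apply: homology_is_iso (snd_bij _) _; apply: homology_TC.
exact: homology_prod_ThetaS (homology_ThetaSS b 0) (homology_Theta1 b).
Qed.

Lemma homology_TC3 n : homology_is R TCab n.+3 'rV[int]_0.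
Proof.
apply: homology_is_trivial; apply: homology_is_acyclic (rV0_eq0 rV_int0) _.
apply: homology_TC.
exact: homology_prod_ThetaS (homology_ThetaSS b n.+1) (homology_ThetaSS b n).
Qed.

End Homology.

Local Close Scope ring_scope.
Local Close Scope classical_set_scope.

Theorem theorem6p1 (R : realType) (alpha beta : nat)
    (halpha : 2 <= alpha) (hbeta : 2 <= beta) :
  [/\ isomorphic (reduced_homology R (TC R alpha beta) 0) 'rV[int]_0,
      isomorphic (reduced_homology R (TC R alpha beta) 1)
        'rV[int]_(alpha + beta - 2),
      isomorphic (reduced_homology R (TC R alpha beta) 2)
        'rV[int]_((alpha - 1) * (beta - 1)) &
      forall n : nat, 3 <= n ->
        isomorphic (reduced_homology R (TC R alpha beta) n) 'rV[int]_0].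
Proof.
case: alpha halpha => // a _; case: beta hbeta => // b _.
have -> : a.+1 + b.+1 - 2 = b + a by lia.
rewrite !subn1 /=; split.
- exact/isomorphic_reduced0/homology_TC0.
- exact/isomorphic_reducedS/homology_TC1.
- exact/isomorphic_reducedS/homology_TC2.
- by case=> [|[|[|n]]] // _; exact/isomorphic_reducedS/homology_TC3.
Qed.
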